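(* There is a function $f:\mathbb N\to\mathbb N$ with $f\ge 1$ and $f(d)=2^{2^{O(d)}}$ such that, for every fixed $d$ and every fixed constant $c>0$, there is an algorithm that, given an $n$-vertex $m$-edge graph $G$ of twin-width at most $d$, outputs an sd-degeneracy sequence of $G$ of width $O(f(d)\log n)$, in time $O(f(d)(m+n)\log n)$ with probability at least $1-n^{-c}$.
   Context: In the paper, $f$ is the function such that every graph of twin-width at most $d$ has versatile twin-width at most $f(d)$. Twin-width: a trigraph is a graph with black and red edges; contracting $u,v$ into $w$ makes $wx$ black if $ux,vx$ both black, absent if neither is an edge, red otherwise. A graph has twin-width at most $d$ if some contraction sequence to a single vertex keeps every intermediate trigraph of maximum red degree at most $d$. For $u,v\in V(G)$, $\mathrm{sd}_G(u,v)=|(N_G(u)\setminus\{v\})\triangle(N_G(v)\setminus\{u\})|$. An sd-degeneracy sequence of an $n$-vertex graph $G$ is a list $(u_1,v_1),\dots,(u_{n-1},v_{n-1})$ of pairs with $u_i\neq v_i$, $V(G)=\{u_1,\dots,u_{n-1},v_{n-1}\}$, and no $i<j$ with $u_i\in\{u_j,v_j\}$. Its width is $\max_{i\in[n-1]}\mathrm{sd}_{G-\{u_1,\dots,u_{i-1}\}}(u_i,v_i)$. *)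

(* Defs.v *)
From mathcomp Require Import all_boot all_order all_algebra.
From mathcomp Require Import boolp reals exp.

Set Implicit Arguments.
Unset Strict Implicit.
Unset Printing Implicit Defensive.

(* A graph on the finite vertex type V is a relation [e : rel V] subject to
   [simple_graph]. *)
Definition simple_graph (V : finType) (e : rel V) : Prop :=
  symmetric e /\ irreflexive e.

Definition edges (V : finType) (e : rel V) : {set {set V}} :=
  [set [set x.1; x.2] | x : V * V & e x.1 x.2].

(** Twin-width *)

(* The vertex set is [tverts]; the values of [tblack] and [tred] outside of it
   are irrelevant. *)
Record trigraph (V : finType) := Trigraph {
  tverts : {set V};
  tblack : rel V;
  tred : rel V
}.

Definition graph_trigraph (V : finType) (e : rel V) : trigraph V :=
  Trigraph [set: V] e (fun _ _ => false).

Definition tadj (V : finType) (H : trigraph V) : rel V :=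
  fun x y => tblack H x y || tred H x y.

(* The vertex w resulting from the contraction of u and v reuses the name u,
   while v leaves the vertex set. *)
Definition contract (V : finType) (H : trigraph V) (u v : V) : trigraph V :=
  let wblack x := tblack H u x && tblack H v x in
  let wred x := (tadj H u x || tadj H v x) && ~~ wblack x in
  Trigraph (tverts H :\ v)
    (fun x y => if x == u then (y != u) && wblack y
                else if y == u then wblack x else tblack H x y)
    (fun x y => if x == u then (y != u) && wred y
                else if y == u then wred x else tred H x y).

Definition red_degree (V : finType) (H : trigraph V) (x : V) : nat :=
  #|[set y in tverts H | tred H x y]|.

Definition max_red_degree (V : finType) (H : trigraph V) : nat :=
  \max_(x in tverts H) red_degree H x.

Inductive has_contraction_seq (V : finType) (d : nat) : trigraph V -> Prop :=
| contraction_seq_end H :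
    #|tverts H| = 1 -> max_red_degree H <= d -> has_contraction_seq d H
| contraction_seq_step H u v :
    u \in tverts H -> v \in tverts H -> u != v -> max_red_degree H <= d ->
    has_contraction_seq d (contract H u v) -> has_contraction_seq d H.

Definition twin_width_le (V : finType) (e : rel V) (d : nat) : Prop :=
  has_contraction_seq d (graph_trigraph e).

(** Symmetric difference and sd-degeneracy *)

Definition nbhd (V : finType) (e : rel V) (S : {set V}) (u : V) : {set V} :=
  [set x in S | e u x].

(* sd of u and v in the subgraph of e induced by S *)
Definition sd (V : finType) (e : rel V) (S : {set V}) (u v : V) : nat :=
  let A := nbhd e S u :\ v in
  let B := nbhd e S v :\ u in
  #|(A :\: B) :|: (B :\: A)|.

(* In the third clause the default (x, x) of [last] is only reached when s is
   empty, i.e. for a one-vertex graph, where the clause becomes void. *)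
Definition sd_degeneracy_seq (V : finType) (s : seq (V * V)) : Prop :=
  [/\ size s = #|V|.-1,
      forall p, p \in s -> p.1 != p.2,
      forall x : V, x \in unzip1 s \/ x = (last (x, x) s).2
    & pairwise (fun p q => (p.1 != q.1) && (p.1 != q.2)) s].

Definition sd_width (V : finType) (e : rel V) (s : seq (V * V)) : nat :=
  \max_(i < size s)
    let p := tnth (in_tuple s) i in
    sd e [set x | x \notin unzip1 (take i s)] p.1 p.2.

(** Randomized word RAM *)

Inductive binop := Add | Sub | Mul | Div | Mod.

(* Arguments are register indices, except for the literal of [Const] and the
   jump targets. *)
Inductive instr :=
| Const of nat & nat            (* R[i] := a              *)
| Arith of binop & nat & nat & nat (* R[i] := R[j] op R[k] *)
| Fetch of nat & nat             (* R[i] := M[R[j]]        *)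
| Store of nat & nat            (* M[R[i]] := R[j]        *)
| Rand of nat                   (* R[i] := uniform random word *)
| Jlt of nat & nat & nat        (* if R[i] < R[j] goto l  *)
| Jmp of nat                    (* goto l                 *)
| Out of nat                    (* append R[i] to the output *)
| Halt.

Definition program := seq instr.

Record config := Config {
  pc : nat;
  regs : nat -> nat;
  mem : nat -> nat;
  out : seq nat
}.

(* Subtraction is truncated at 0, and division by 0 follows [divn] and
   [modn]; all results are then reduced to w bits. *)
Definition eval_binop (o : binop) (x y : nat) : nat :=
  match o with
  | Add => x + y
  | Sub => x - y
  | Mul => x * y
  | Div => x %/ y
  | Mod => x %% y
  end.

(* Leaving the program counts as halting. *)
Definition cur_instr (P : program) (c : config) : instr := nth Halt P (pc c).

Definition halted (P : program) (c : config) : bool :=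
  if cur_instr P c is Halt then true else false.

(* One step with word size w; x is the random word available at that step. *)
Definition step (w : nat) (P : program) (c : config) (x : nat) : config :=
  let: Config p r M o := c in
  let set_reg i a := Config p.+1 [eta r with i |-> a %% 2 ^ w] M o in
  match cur_instr P c with
  | Const i a => set_reg i a
  | Arith op i j k => set_reg i (eval_binop op (r j) (r k))
  | Fetch i j => set_reg i (M (r j))
  | Store i j => Config p.+1 r [eta M with r i |-> r j] o
  | Rand i => set_reg i x
  | Jlt i j l => Config (if r i < r j then l else p.+1) r M o
  | Jmp l => Config l r M o
  | Out i => Config p.+1 r M (rcons o (r i))
  | Halt => c
  end.

Definition init_config (w : nat) (input : seq nat) : config :=
  Config 0 (fun _ => 0) (fun i => nth 0 input i %% 2 ^ w) [::].

(* One step per item of the tape: the i-th step has access to the i-th word. *)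
Definition run (w : nat) (P : program) (input tape : seq nat) : config :=
  foldl (step w P) (init_config w input) tape.

(* Probability, over T independent uniform w-bit words, that P halts within T
   steps with an output satisfying good. *)
Definition success_prob (R : realType) (w : nat) (P : program)
    (input : seq nat) (T : nat) (good : seq nat -> Prop) : R :=
  (#|[set t : T.-tuple 'I_(2 ^ w) |
       let c := run w P input [seq val x | x <- t] in
       halted P c && `[< good (out c) >]]|%:R
   / #|{: T.-tuple 'I_(2 ^ w)}|%:R)%R.

(** Encoding of the input and of the output *)

(* adj lists the neighbours of every vertex, in arbitrary order. *)
Definition adjacency_lists (n : nat) (e : rel 'I_n) (adj : 'I_n -> seq 'I_n) :
    Prop :=
  forall u, perm_eq (adj u) (enum (e u)).

(* Memory layout: n, m, then n.+1 addresses a_0, ..., a_n, then the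
   concatenation of the lists, that of vertex i occupying a_i, ..., a_(i+1) - 1. *)
Definition encode_graph (n m : nat) (adj : 'I_n -> seq 'I_n) : seq nat :=
  [:: n; m] ++
  [seq n + 3 + \sum_(u < n | u < i) size (adj u) | i <- iota 0 n.+1] ++
  flatten [seq [seq val v | v <- adj u] | u <- enum 'I_n].

Definition encode_seq (n : nat) (s : seq ('I_n * 'I_n)) : seq nat :=
  flatten [seq [:: val p.1; val p.2] | p <- s].

(* Number of bits of n *)
Definition bit_length (n : nat) : nat := (trunc_log 2 n).+1.

(* Main.v *)
Require Import Defs.
From mathcomp Require Import all_boot all_order all_algebra.
From mathcomp Require Import boolp reals sequences exp.
From mathcomp Require Import zify ring lra.

(** In a graph of twin-width at most [d], the number of traces [N(v) :&: X] of
    neighbourhoods on a vertex set [X] is at most [(d + 1) 2^(d + 2) |X| + 1].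
    Indeed, follow the contraction sequence until two vertices [x], [y] of [X] get
    merged for the first time: every part then contains at most one vertex of
    [X :\ x], so the trace of a vertex is determined by its part up to [d + 2]
    elements, and only the vertices of at most [d + 1] parts separate [x] from
    [y]. Removing [x] from [X] thus loses at most [(d + 1) 2^(d + 2)] traces.

    Put [q = 2^(2 d + 4)]. While [r >= q] vertices remain, draw [r / q] of them
    with replacement, group the remaining vertices by their trace on this sample,
    and delete all but one vertex of each group, pairing every deleted vertex with
    the survivor of its group. There are at most [r / 2] groups, so there are
    [O(log n)] rounds, each taking linear time by partition refinement. With high
    probability every sample meets every symmetric difference with more than
    [O(q log n)] elements, which bounds the width. When fewer than [q] vertices are
    left, any order will do. *)

(** The halving of a round holds for every sample, so the bounds on the number of rounds and on the
    time hold on every tape; only the width is at risk. A round draws at most half as many words as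
    there are vertices and at least halves them, so [n] words suffice in all. The machine model is
    the obstacle: step i sees word i of the tape, and words read at times that depend on earlier
    words would be awkward to prove independent. The program therefore draws its [n] words in a
    prelude of fixed timing and is deterministic afterwards. This separates the correctness of the
    program (its output is that of [algo] on the drawn words) from the probability estimate, which
    concerns [algo] alone. Failure of a round is an event about the vertex set at its start: some
    pair with a large symmetric difference there is not separated by the sample. Deletions only
    shrink symmetric differences, so a union bound over at most n^2 pairs per round is enough. *)

Set Implicit Arguments.
Unset Strict Implicit.
Unset Printing Implicit Defensive.

(** * Neighbourhood complexity *)

Section NeighbourhoodComplexity.
Variables (V : finType) (e : rel V).
Hypothesis e_simple : simple_graph e.

Definition trace (X : {set V}) (v : V) : {set V} := [set x in X | e v x].

Definition traces (X : {set V}) : {set {set V}} := [set trace X v | v : V].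

(* p sends every vertex of the graph to the trigraph vertex it has been
   contracted into. *)
Definition realizes (H : trigraph V) (p : V -> V) : Prop :=
  (forall u, p u \in tverts H) /\
  (forall u v, p u != p v ->
     (tblack H (p u) (p v) -> e u v) /\ (e u v -> tadj H (p u) (p v))).

Lemma realizes_graph : realizes (graph_trigraph e) id.
Proof. by split=> [u|u v _]; rewrite ?inE // /tadj /= orbF. Qed.

Lemma realizes_contract H p u v : realizes H p -> u \in tverts H -> u != v ->
  realizes (contract H u v) (fun x => if p x == v then u else p x).
Proof.
case: e_simple => sym_e _ [pH hp] uH uv; split=> [x|x y].
  by rewrite !inE; case: (altP (p x =P v)) => [_|->]; rewrite ?uv ?uH ?pH.
have uvF : (u == v) = false by apply/negbTE.
rewrite /tadj /=.
have [px|px] := altP (p x =P v); have [py|py] := altP (p y =P v).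
- by rewrite eqxx.
- rewrite eqxx eq_sym => yu; rewrite yu /=.
  have := hp x y; rewrite px eq_sym py => /(_ isT); rewrite /tadj => -[h1 h2].
  split=> [/andP[_ /h1]//|/h2 h].
  by rewrite h orbT /= orbN.
- rewrite eqxx => yu; rewrite (negbTE yu).
  have := hp y x; rewrite py eq_sym px => /(_ isT); rewrite /tadj => -[h1 h2].
  split=> [/andP[_ /h1]|]; first by rewrite sym_e.
  by rewrite sym_e => /h2 h; rewrite h orbT /= orbN.
have [xu|xu] := altP (p x =P u).
  rewrite eq_sym xu => yu; rewrite yu /=.
  have := hp x y; rewrite xu eq_sym yu => /(_ isT); rewrite /tadj => -[h1 h2].
  split=> [/andP[/h1]//|/h2 h].
  by rewrite h /= orbN.
have [yu|yu] := altP (p y =P u).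
  move=> _; have := hp y x; rewrite yu eq_sym xu => /(_ isT).
  rewrite /tadj => -[h1 h2].
  split=> [/andP[/h1]|]; first by rewrite sym_e.
  by rewrite sym_e => /h2 h; rewrite h /= orbN.
by move=> /hp.
Qed.

Lemma contraction_seq_red_degree d (H : trigraph V) :
  has_contraction_seq d H -> max_red_degree H <= d.
Proof. by case. Qed.

Lemma first_merge d (H : trigraph V) (X : {set V}) (p : V -> V) :
  has_contraction_seq d H -> realizes H p -> {in X &, injective p} ->
  1 < #|X| ->
  exists (H' : trigraph V) (p' : V -> V) (x y : V),
    [/\ x \in X, y \in X :\ x, p' x = p' y & {in X :\ x &, injective p'}] /\
    (realizes H' p' /\ max_red_degree H' <= d).
Proof.
move=> Hseq; elim: Hseq p => {H} [H H1 _ p [pH _] p_inj|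
  H u v uH vH uv _ Hseq IH p Hp p_inj X1].
  rewrite -(card_in_imset p_inj) ltnNge -H1 subset_leq_card //.
  by apply/subsetP => _ /imsetP[x _ ->].
have Hp' := realizes_contract (v := v) Hp uH uv.
set p' := fun x => _ in Hp'.
have p'E x y : p' x = p' y -> p x = p y \/
    (p x = u /\ p y = v) \/ (p x = v /\ p y = u).
  by rewrite /p'; case: eqP => [->|]; case: eqP => [->|]; auto.
have [p'_inj|] := pselect ({in X &, injective p'}); first exact: (IH p').
move=> not_inj.
have [x [y [xX yX xy p'xy]]] : exists x y, [/\ x \in X, y \in X, x != y & p' x = p' y].
  apply: contrapT => h; apply: not_inj => x y xX yX p'xy.
  by apply: contrapT => /eqP xy; apply: h; exists x, y.
exists (contract H u v), p', x, y; split; last first.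
  by split=> //; exact: contraction_seq_red_degree.
split=> //; first by rewrite !inE eq_sym xy.
move=> z z' /setD1P[zx zX] /setD1P[z'x z'X] /p'E[/p_inj -> //|pz].
case/p'E: p'xy => [/p_inj|pxy]; first by move=> /(_ xX yX) /eqP; rewrite (negbTE xy).
(* Both [p z], [p z'] and [p x], [p y] are the contracted pair in some order, so [z] or [z'] was in
   the part of [x] before the contraction, where [p] is still injective on [X]. *)
exfalso; have [pzx|pz'x] : p z = p x \/ p z' = p x.
  by case: pz => -[-> ->]; case: pxy => -[-> _]; auto.
  by move/p_inj: pzx => /(_ zX xX) /eqP; rewrite (negbTE zx).
by move/p_inj: pz'x => /(_ z'X xX) /eqP; rewrite (negbTE z'x).
Qed.

Lemma red_nbhd_card d (H : trigraph V) (P : V) :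
  max_red_degree H <= d -> P \in tverts H ->
  #|P |: [set b in tverts H | tred H P b]| <= d.+1.
Proof.
move=> Hd PH; rewrite (leq_trans (leq_card_setU _ _)) // cards1 add1n ltnS.
by rewrite (leq_trans _ Hd) // /max_red_degree (bigD1 P) //= leq_maxl.
Qed.

Lemma homogeneous H p u v : realizes H p -> p u != p v ->
  ~~ tred H (p u) (p v) -> e u v = tblack H (p u) (p v).
Proof.
move=> [_ hp] /hp[h1 h2] nred; apply/idP/idP => [/h2|/h1 //].
by rewrite /tadj (negbTE nred) orbF.
Qed.

(** A part outside the closed red neighbourhood [N] of [b] is completely joined to [b] or not at
    all, so traces coming from [b] can differ only on [U]. Each of the at most [d.+1] parts of [N]
    holds at most one vertex of [X :\ x], and [x] itself may come on top. *)
Lemma part_traces_card d H p (X : {set V}) (x b : V) :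
  realizes H p -> max_red_degree H <= d -> b \in tverts H ->
  {in X :\ x &, injective p} ->
  #|[set trace X v | v in [set v | p v == b]]| <= 2 ^ d.+2.
Proof.
move=> Hp Hd bH p_inj.
pose N := b |: [set c in tverts H | tred H b c].
pose U := [set z in X | p z \in N].
have U_card : #|U| <= d.+2.
  rewrite (cardsD1 x) -[d.+2]add1n leq_add ?leq_b1 //.
  rewrite -(card_in_imset (f := p)).
    rewrite (leq_trans _ (red_nbhd_card Hd bH)) // subset_leq_card //.
    by apply/subsetP => _ /imsetP[z + ->]; rewrite !inE => /and3P[_ _].
  move=> z z' hz hz'; apply: p_inj.
    by move: hz; rewrite !inE => /and3P[-> ->].
  by move: hz'; rewrite !inE => /and3P[-> ->].
have -> : #|[set trace X v | v in [set v | p v == b]]| =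
    #|[set A :&: U | A in [set trace X v | v in [set v | p v == b]]]|.
  apply/esym/card_in_imset => _ _ /imsetP[v + ->] /imsetP[v' + ->].
  rewrite !inE => /eqP pv /eqP pv' /setP eqU; apply/setP => z.
  have := eqU z; rewrite !inE; case: (z \in X) => //=.
  have [zN|] := boolP ((p z == b) || (p z \in tverts H) && tred H b (p z)).
    by rewrite !andbT.
  rewrite (proj1 Hp) negb_or => /andP[pzb nred] _.
  by rewrite !(homogeneous Hp) ?pv ?pv' // eq_sym.
rewrite (@leq_trans #|powerset U|) //.
  rewrite subset_leq_card //; apply/subsetP => _ /imsetP[A _ ->].
  by rewrite inE subsetIr.
by rewrite card_powerset leq_pexp2l.
Qed.

Lemma traces_remove d (X : {set V}) : twin_width_le e d -> 1 < #|X| ->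
  exists2 x, x \in X & #|traces X| <= #|traces (X :\ x)| + d.+1 * 2 ^ d.+2.
Proof.
move=> tw X1.
have [H [p [x [y [[xX yX pxy p_inj] [Hp Hd]]]]]] :=
  first_merge tw realizes_graph (fun u v _ _ => id) X1.
exists x => //.
pose Dst : {set {set V}} := [set A : {set V} | (x \in A) != (y \in A)].
rewrite -(cardsID Dst) addnC leq_add //.
  (* A trace that does not separate x from y is determined by its elements other than x. *)
  rewrite -(card_in_imset (f := fun A : {set V} => A :\ x)).
    rewrite subset_leq_card //; apply/subsetP => _ /imsetP[A /setDP[+ _] ->].
    move=> /imsetP[v _ ->]; apply/imsetP; exists v => //.
    by apply/setP => z; rewrite !inE andbA.
  move=> A B; rewrite !inE !negbK => /andP[/eqP xA _] /andP[/eqP xB _].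
  move=> /setP eqAB; apply/setP => z; have [->|zx] := eqVneq z x.
    have := eqAB y; rewrite !inE xA xB.
    by have [yx|//] := eqVneq y x; move: yX; rewrite yx !inE eqxx.
  by have := eqAB z; rewrite !inE zx.
have yxX : y \in X by case/setD1P: yX.
pose Q := p x |: [set b in tverts H | tred H (p x) b].
(* A vertex whose part is outside [Q] is homogeneous towards the common part of [x] and [y], hence
   sees both or neither: all separating traces come from parts in [Q]. *)
apply: (@leq_trans #|\bigcup_(b in Q) [set trace X v | v in [set v | p v == b]]|).
  apply/subset_leq_card/subsetP => _ /setIP[/imsetP[v _ ->]].
  rewrite !inE xX yxX /= => dist; apply/bigcupP; exists (p v); last first.
    by apply/imsetP; exists v => //; rewrite inE.
  rewrite !inE (proj1 Hp) /=; apply: contraNT dist; rewrite negb_or.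
  case: e_simple => sym_e _; rewrite eq_sym => /andP[pxv nred].
  by rewrite sym_e [e v y]sym_e !(homogeneous Hp) // -?pxy ?pxv ?nred.
apply: (@leq_trans (\sum_(b in Q) 2 ^ d.+2)); last first.
  by rewrite sum_nat_const leq_mul2r red_nbhd_card ?orbT // (proj1 Hp).
apply: (big_ind2 (fun (A : {set {set V}}) k => #|A| <= k)); first by rewrite cards0.
  by move=> A a B b hA hB; rewrite (leq_trans (leq_card_setU _ _)) ?leq_add.
move=> b; rewrite !inE => bQ; apply: (part_traces_card (x := x) Hp) => //.
by case/orP: bQ => [/eqP ->|/andP[]//]; exact: (proj1 Hp).
Qed.

Theorem neighbourhood_complexity d (X : {set V}) : twin_width_le e d ->
  #|traces X| <= #|X| * (d.+1 * 2 ^ d.+2) + 1.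
Proof.
move=> tw; elim: {X}_.+1 {-2}X (ltnSn #|X|) => // N IH X; rewrite ltnS => XN.
have [X1|X1] := leqP #|X| 1.
  apply: (@leq_trans (2 ^ #|X|)).
    rewrite -card_powerset subset_leq_card //; apply/subsetP => _ /imsetP[v _ ->].
    by rewrite inE; apply/subsetP => z; rewrite inE => /andP[].
  by case: #|X| X1 => [|[|]] //; rewrite !expnS; nia.
have [x xX le_x] := traces_remove tw X1.
have cX : #|X| = #|X :\ x|.+1 by rewrite (cardsD1 x) xX.
have := IH (X :\ x); rewrite -cX => /(_ XN); rewrite cX; nia.
Qed.

(** By [d.+1 <= 2 ^ d] the factor is at most 2^(2d+2); one more doubling absorbs the additive 1, as
    [k] is positive. *)
Lemma neighbourhood_complexity_le d k (X : {set V}) : twin_width_le e d ->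
  0 < k -> #|X| <= k -> #|traces X| <= k * 2 ^ (2 * d + 3).
Proof.
move=> tw k0 Xk; apply: leq_trans (neighbourhood_complexity X tw) _.
have d2 : d.+1 <= 2 ^ d by rewrite ltn_expl.
have -> : 2 ^ (2 * d + 3) = 2 ^ d * 2 ^ d.+2 + 2 ^ d * 2 ^ d.+2.
  by rewrite -expnD addnn -mul2n -expnS; congr (2 ^ _); lia.
have : #|X| * (d.+1 * 2 ^ d.+2) <= k * (2 ^ d * 2 ^ d.+2).
  by rewrite leq_mul // leq_mul2r d2 orbT.
have : 0 < 2 ^ d * 2 ^ d.+2 by rewrite muln_gt0 !expn_gt0.
nia.
Qed.

End NeighbourhoodComplexity.

(** * The algorithm on lists of vertices *)

Section Elimination.
Variables (V : finType) (e : rel V).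
Hypothesis e_simple : simple_graph e.

Definition diff_set (S : {set V}) (u v : V) : {set V} :=
  [set x in S | e x u != e x v].

(** To be used with [S'] the vertex set at the start of a round and [S] the one when a vertex is
    deleted: a bound valid at the start persists during the round. *)
Lemma sd_le_diff_set (S S' : {set V}) u v :
  S \subset S' -> sd e S u v <= #|diff_set S' u v|.
Proof.
case: e_simple => sym_e irr_e /subsetP SS'.
apply/subset_leq_card/subsetP => x.
rewrite !inE ![e x _]sym_e.
have [->|xu] := eqVneq x u; first by rewrite irr_e !andbF.
have [->|xv] := eqVneq x v; first by rewrite irr_e !andbF.
have [xS|_] := boolP (x \in S); last by rewrite !andbF.
by rewrite (SS' _ xS); case: (e u x); case: (e v x).
Qed.

(** Local form of an sd-degeneracy sequence; making both the initial and the final vertex set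
    explicit lets the rounds be concatenated. *)
Fixpoint eliminates (delta : nat) (S : {set V}) (s : seq (V * V)) (S' : {set V}) :
    Prop :=
  if s is p :: s' then
    [/\ p.1 \in S, p.2 \in S, p.1 != p.2, sd e S p.1 p.2 <= delta
      & eliminates delta (S :\ p.1) s' S']
  else S = S'.

Variable delta : nat.

Lemma eliminates_cat S1 S2 S3 s t : eliminates delta S1 s S2 ->
  eliminates delta S2 t S3 -> eliminates delta S1 (s ++ t) S3.
Proof.
elim: s S1 => [|p s IH] S1 /=; first by move=> ->.
by move=> [? ? ? ? h] h'; split=> //; apply: IH.
Qed.

Lemma eliminates_mem S s S' q : eliminates delta S s S' -> q \in s ->
  [/\ q.1 \in S, q.2 \in S & q.1 != q.2].
Proof.
elim: s S => // p s IH S /= [pS1 pS2 p12 _ /IH h]; rewrite inE.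
by case/predU1P => [->//|/h[/setD1P[_ ?] /setD1P[_ ?]]].
Qed.

Lemma eliminates_card S s S' : eliminates delta S s S' -> size s + #|S'| = #|S|.
Proof.
elim: s S => [|p s IH] S /=; first by move=> ->.
by move=> [pS _ _ _ /IH]; rewrite (cardsD1 p.1 S) pS; lia.
Qed.

Lemma eliminates_cover S s S' x : eliminates delta S s S' -> x \in S ->
  x \in unzip1 s \/ x \in S'.
Proof.
elim: s S => [|p s IH] S /=; first by move=> ->; right.
move=> [pS _ _ _ /IH h] xS; rewrite inE.
have [->|xp] := eqVneq x p.1; [by left | by apply: h; rewrite !inE xp].
Qed.

Lemma eliminates_pairwise S s S' : eliminates delta S s S' ->
  pairwise (fun p q => (p.1 != q.1) && (p.1 != q.2)) s.
Proof.
elim: s S => //= p s IH S [_ _ _ _ h]; rewrite (IH _ h) andbT.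
apply/allP => q /(eliminates_mem h)[/setD1P[+ _] /setD1P[+ _] _].
by rewrite ![p.1 == _]eq_sym => -> ->.
Qed.

Lemma eliminates_last S s S' p0 : eliminates delta S s S' -> s != [::] ->
  (last p0 s).2 \in S'.
Proof.
elim: s S p0 => // p s IH S p0 /= [_ p2S p12 _ h] _.
case: s IH h => [_ /= <-|p' s IH h]; first by rewrite !inE eq_sym p12.
exact: (IH _ _ h).
Qed.

Lemma eliminates_sd S s S' p0 i : eliminates delta S s S' -> i < size s ->
  sd e (S :\: [set x in unzip1 (take i s)]) (nth p0 s i).1 (nth p0 s i).2 <= delta.
Proof.
elim: s S i => // p s IH S [|i] /= [_ _ _ sd_p h].
  suff -> : S :\: [set x in [::]] = S by [].
  by apply/setP => x; rewrite !inE.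
rewrite ltnS => /(IH _ _ h).
suff -> : S :\ p.1 :\: [set x in unzip1 (take i s)] =
  S :\: [set x in p.1 :: unzip1 (take i s)] by [].
by apply/setP => x; rewrite !inE negb_or andbA [(x != p.1) && _]andbC.
Qed.

(** The partner in the last pair survives, so it is [z], the only vertex that is never a first
    component; this gives the covering clause. *)
Lemma eliminates_sd_degeneracy s z : eliminates delta [set: V] s [set z] ->
  sd_degeneracy_seq s /\ sd_width e s <= delta.
Proof.
move=> h; split.
  split.
  - by have := eliminates_card h; rewrite cards1 cardsT; lia.
  - by move=> p /(eliminates_mem h)[].
  - move=> x; have [s0|s0] := eqVneq s [::].
      by right; rewrite s0.
    have := eliminates_last (x, x) h s0; rewrite inE => /eqP ->.
    have [|xs|] := eliminates_cover (x := x) h; rewrite ?inE //; first by left.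
    by move=> /eqP; right.
  - exact: eliminates_pairwise h.
apply/bigmax_leqP => i _; have p0 : V * V by exact: (tnth (in_tuple s) i).
rewrite (tnth_nth p0) /=.
suff -> : [set x | x \notin unzip1 (take i s)] =
  [set: V] :\: [set x in unzip1 (take i s)] by exact: (eliminates_sd _ h).
by apply/setP => x; rewrite !inE andbT.
Qed.

End Elimination.

Section Algorithm.
Variables (V : finType) (e : rel V) (x0 : V) (q : nat).

Definition same_trace (X : seq V) : rel V :=
  fun u v => all (fun x => e x u == e x v) X.

(* acc holds the representatives of the classes met so far. *)
Fixpoint reps (eqv : rel V) (acc A : seq V) : seq V :=
  if A is v :: A' then
    reps eqv (if has (eqv v) acc then acc else rcons acc v) A'
  else acc.

Fixpoint merges (eqv : rel V) (acc A : seq V) : seq (V * V) :=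
  if A is v :: A' then
    if has (eqv v) acc then
      (v, nth v acc (find (eqv v) acc)) :: merges eqv acc A'
    else merges eqv (rcons acc v) A'
  else [::].

(** The choice is only nearly uniform, since [size A] need not divide the number of words;
    [miss_prob] pays a factor 2 for this. *)
Definition sample (A : seq V) (ws : seq nat) : seq V :=
  [seq nth x0 A (x %% size A) | x <- ws].

Definition star (A : seq V) : seq (V * V) :=
  [seq (v, head x0 A) | v <- behead A].

Definition survivors (A : seq V) (ws : seq nat) : seq V :=
  reps (same_trace (sample A (take (size A %/ q) ws))) [::] A.

Definition round_pairs (A : seq V) (ws : seq nat) : seq (V * V) :=
  merges (same_trace (sample A (take (size A %/ q) ws))) [::] A.

(** If rounds halve the list and [size A < 2 ^ fuel], the fuel does not run out while [q] vertices
    or more remain. *)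
Fixpoint algo (fuel : nat) (A : seq V) (ws : seq nat) : seq (V * V) :=
  if (fuel, size A %/ q) is (fuel'.+1, _.+1) then
    round_pairs A ws ++ algo fuel' (survivors A ws) (drop (size A %/ q) ws)
  else star A.

Definition round_fails (delta : nat) (A : seq V) (ws : seq nat) : bool :=
  [exists u in A, exists v in A,
     (delta < #|diff_set e [set x in A] u v|) && same_trace (sample A ws) u v].

(** The recursion is that of [algo], so that each round, given the vertices that reach it, is judged
    on a block of words of its own. *)
Fixpoint fails (delta fuel : nat) (A : seq V) (ws : seq nat) : bool :=
  if (fuel, size A %/ q) is (fuel'.+1, _.+1) then
    round_fails delta A (take (size A %/ q) ws) ||
    fails delta fuel' (survivors A ws) (drop (size A %/ q) ws)
  else false.

Lemma reps_uniq eqv acc A : uniq (acc ++ A) -> uniq (reps eqv acc A).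
Proof.
elim: A acc => [|v A IH] acc /=; first by rewrite cats0.
case: ifP => _ h; apply: IH; last by rewrite cat_rcons.
by move: h; rewrite !cat_uniq /= negb_or => /and3P[-> /andP[_ ->] /andP[_ ->]].
Qed.

Lemma reps_size eqv acc A : size acc <= size (reps eqv acc A).
Proof.
elim: A acc => //= v A IH acc; apply: leq_trans (IH _).
by case: ifP; rewrite ?size_rcons.
Qed.

Lemma reps_size_gt0 eqv A : 0 < size A -> 0 < size (reps eqv [::] A).
Proof. by case: A => //= v A _; apply: leq_trans (reps_size _ _ _). Qed.

Lemma trace_same X u v : symmetric e ->
  (trace e [set x in X] u == trace e [set x in X] v) = same_trace X u v.
Proof.
move=> sym_e; apply/eqP/allP => [/setP h x xX|h].
  by have := h x; rewrite !inE xX /= ![e x _]sym_e => ->.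
apply/setP => x; rewrite !inE; case: (boolP (x \in X)) => // xX.
by rewrite ![e _ x]sym_e; apply/eqP/h.
Qed.

Lemma reps_size_traces X A : symmetric e ->
  size (reps (same_trace X) [::] A) <= #|traces e [set x in X]|.
Proof.
move=> sym_e; pose f := trace e [set x in X].
suff h acc : uniq (map f acc) -> uniq (map f (reps (same_trace X) acc A)).
  rewrite -(size_map f); have /card_uniqP <- := h [::] isT.
  by apply/subset_leq_card/subsetP => _ /mapP[v _ ->]; rewrite imset_f.
elim: A acc => //= v A IH acc acc_uniq; apply: IH; case: ifP => // /hasPn h.
rewrite map_rcons rcons_uniq acc_uniq andbT; apply/mapP => -[u /h].
by rewrite -trace_same // => /eqP.
Qed.

Hypothesis e_simple : simple_graph e.

(** The vertices present are always those of [acc ++ A]: a representative never leaves [acc], so it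
    is still there when a later vertex is paired with it. *)
Lemma merges_eliminates delta (S0 : {set V}) (eqv : rel V) acc A : uniq (acc ++ A) ->
  {subset acc ++ A <= S0} ->
  (forall u v, u \in S0 -> v \in S0 -> eqv u v -> #|diff_set e S0 u v| <= delta) ->
  eliminates e delta [set x in acc ++ A] (merges eqv acc A) [set x in reps eqv acc A].
Proof.
move=> + + small; elim: A acc => [|v A IH] acc /=; first by rewrite cats0.
move=> uniq_A sub_A; case: ifP => [|_]; last first.
  by rewrite -cat_rcons; apply: IH; rewrite cat_rcons.
move=> hasv /=; have find_lt := hasv; rewrite has_find in find_lt.
have u_acc := mem_nth v find_lt; have eqvu := nth_find v hasv.
set u := nth v _ _ in u_acc eqvu *.
have vu : v != u.
  apply: contraTneq uniq_A => ->; rewrite cat_uniq /= negb_or.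
  by rewrite u_acc /= andbF.
have vS : v \in acc ++ v :: A by rewrite mem_cat inE eqxx orbT.
have uS : u \in acc ++ v :: A by rewrite mem_cat u_acc.
split; rewrite ?inE //.
  apply: leq_trans (small v u _ _ eqvu); rewrite ?sub_A //.
  by apply: sd_le_diff_set => //; apply/subsetP => x; rewrite inE => /sub_A.
suff -> : [set x in acc ++ v :: A] :\ v = [set x in acc ++ A].
  apply: IH.
    move: uniq_A; rewrite !cat_uniq /= negb_or.
    by move=> /and3P[-> /andP[_ ->] /andP[_ ->]].
  by move=> x; rewrite mem_cat => xA; apply: sub_A; rewrite mem_cat inE orbCA xA orbT.
apply/setP => x; rewrite !inE !mem_cat inE.
have [->|//] := eqVneq x v.
move: uniq_A; rewrite cat_uniq /= negb_or.
by move=> /and3P[_ /andP[/negbTE -> _] /andP[/negbTE -> _]].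
Qed.

Lemma star_eliminates delta A : uniq A -> 0 < size A <= delta ->
  exists z, eliminates e delta [set x in A] (star A) [set z].
Proof.
case: A => // z A; rewrite /star /= => /andP[zA uA] Ad; exists z.
elim: A zA uA Ad => [|v A IH] zA uA Ad.
  by apply/setP => x; rewrite !inE.
move: zA uA Ad; rewrite /= !inE negb_or => /andP[zv zA] /andP[vA uA] Ad.
split; rewrite ?eqxx ?orbT //; first by rewrite eq_sym.
  apply: leq_trans (sd_le_diff_set e_simple _ _ (subxx _)) _.
  apply: leq_trans Ad.
  apply: leq_trans (card_size (z :: v :: A)).
  by apply/subset_leq_card/subsetP => x; rewrite !inE => /andP[].
suff -> : [set x in [:: z, v & A]] :\ v = [set x in z :: A].
  by apply: IH => //; lia.
apply/setP => x; rewrite !inE; have [->|] := eqVneq x v => //=.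
by rewrite eq_sym (negbTE zv) (negbTE vA).
Qed.

Hypothesis halves : forall A ws,
  0 < size A %/ q -> 2 * size (survivors A ws) <= size A.

Lemma algo_eliminates delta fuel A ws : 0 < q <= delta -> uniq A ->
  0 < size A < 2 ^ fuel -> ~~ fails delta fuel A ws ->
  exists z, eliminates e delta [set x in A] (algo fuel A ws) [set z].
Proof.
move=> qd; elim: fuel A ws => [|fuel IH] A ws uA /andP[A0 Afuel].
  by move: A0 Afuel; rewrite expn0; lia.
rewrite /=; case k0: (size A %/ q) => [|k].
  move=> _; apply: star_eliminates; rewrite ?A0 //=.
  case/andP: qd => q0 qd; apply: leq_trans qd; apply: ltnW.
  by rewrite ltnNge -(divn_gt0 _ q0) k0 ltnn.
have Ak : 0 < size A %/ q by rewrite k0.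
rewrite -k0 negb_or => /andP[round_ok rest_ok].
have [z Hz] : exists z, eliminates e delta [set x in survivors A ws]
    (algo fuel (survivors A ws) (drop (size A %/ q) ws)) [set z].
  apply: IH => //; first exact: reps_uniq.
  rewrite reps_size_gt0 //= -(ltn_pmul2l (isT : 0 < 2)) -expnS.
  exact: leq_ltn_trans (halves ws Ak) Afuel.
exists z; apply: eliminates_cat Hz.
apply: (@merges_eliminates delta [set x in A] _ [::]) => // [x|u v].
  by rewrite inE.
rewrite !inE => uA' vA' uv; rewrite leqNgt; apply: contra round_ok => uvd.
by apply/exists_inP; exists u => //; apply/exists_inP; exists v => //; rewrite uvd.
Qed.

End Algorithm.

(** * Probability of failure *)

Import Order.TTheory GRing.Theory Num.Theory.

(** [picks 8 4] will extract the words read by [Rand], the fifth of the eight steps of an iteration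
    of the initial loop of the program. *)
Fixpoint picks (B b N : nat) (s : seq nat) : seq nat :=
  if N is N'.+1 then nth 0 s b :: picks B b N' (drop B s) else [::].

Lemma picks_size Bl b N s : size (picks Bl b N s) = N.
Proof. by elim: N s => //= N IH s; rewrite IH. Qed.

Lemma picks_all (Q : pred nat) Bl b N s : b < Bl -> Bl * N <= size s -> all Q s ->
  all Q (picks Bl b N s).
Proof.
move=> bB; elim: N s => //= N IH s; rewrite mulnS => sz Qs.
have b_s : b < size s by lia.
rewrite (allP Qs) ?mem_nth //=; apply: IH; first by rewrite size_drop; lia.
by apply/allP => x /mem_drop /(allP Qs).
Qed.

Lemma picks_take Bl b N t s : b < Bl -> Bl * N <= t ->
  picks Bl b N (take t s) = picks Bl b N s.
Proof.
move=> bB; elim: N t s => //= N IH t s; rewrite mulnS => Nt.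
rewrite nth_take; last by lia.
rewrite -{1}(subnK (leq_trans (leq_addr _ _) Nt : Bl <= t)) -take_drop IH //.
by lia.
Qed.

(** * Expectation over independent uniform words *)

Section Expectation.
Variables (R : realType) (W : nat).
Hypothesis W_gt0 : (0 < W)%N.
Local Open Scope ring_scope.

(** Averaging one word at a time makes conditioning on the first words a plain induction;
    [card_tuple_expect] links it to the counting of tuples. *)
Fixpoint expect (T : nat) (g : seq nat -> R) : R :=
  if T is T'.+1 then (\sum_(x < W) expect T' (fun s => g (val x :: s))) / W%:R
  else g [::].

Let W_neq0 : W%:R != 0 :> R. Proof. by rewrite pnatr_eq0 -lt0n. Qed.

Let W_ge0 : 0 <= W%:R^-1 :> R. Proof. by rewrite invr_ge0. Qed.

Lemma le_expect T g h :
  (forall s, size s = T -> all (fun x => (x < W)%N) s -> g s <= h s) ->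
  expect T g <= expect T h.
Proof.
elim: T g h => [|T IH] g h gh /=; first exact: gh.
rewrite ler_wpM2r // ler_sum // => x _; apply: IH => s sT sW.
by apply: gh; rewrite /= ?sT // ltn_ord.
Qed.

Lemma eq_expect T g h :
  (forall s, size s = T -> all (fun x => (x < W)%N) s -> g s = h s) ->
  expect T g = expect T h.
Proof. by move=> gh; apply/le_anti; rewrite !le_expect // => s ? ?; rewrite gh. Qed.

Lemma expect_const T a : expect T (fun=> a) = a.
Proof.
elim: T => //= T IH; rewrite IH sumr_const card_ord -[a *+ _]mulr_natr.
by rewrite mulfK.
Qed.

Lemma expectD T g h : expect T (fun s => g s + h s) = expect T g + expect T h.
Proof.
elim: T g h => //= T IH g h; rewrite -mulrDl -big_split /=.
by congr (_ / _); apply: eq_bigr => x _; rewrite IH.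
Qed.

Lemma expect_sum (I : finType) T (g : I -> seq nat -> R) :
  expect T (fun s => \sum_i g i s) = \sum_i expect T (g i).
Proof.
elim: T g => //= T IH g; rewrite -mulr_suml exchange_big /=.
by congr (_ / _); apply: eq_bigr => x _; rewrite IH.
Qed.

Lemma expect_cat T U g :
  expect (T + U) g = expect T (fun s => expect U (fun t => g (s ++ t))).
Proof.
elim: T g => //= T IH g; congr (_ / _).
by apply: eq_bigr => x _; rewrite IH.
Qed.

Lemma expect_all T (P : pred nat) :
  expect T (fun s => (all P s)%:R) = (#|[set x : 'I_W | P x]|%:R / W%:R) ^+ T.
Proof.
elim: T => [|T IH] /=; first by rewrite expr0.
rewrite exprS -IH mulrAC; congr (_ / _).
rewrite -sum1dep_card natr_sum mulr_suml [RHS]big_mkcond /=.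
apply: eq_bigr => x _; case: (P x); first by rewrite mul1r.
exact: expect_const.
Qed.

Lemma expect_nth B b (g : nat -> R) : (b < B)%N ->
  expect B (fun s => g (nth 0%N s b)) = (\sum_(x < W) g x) / W%:R.
Proof.
elim: B b => // B IH [|b] /= bB.
  by congr (_ / _); apply: eq_bigr => x _; rewrite expect_const.
rewrite (eq_bigr (fun=> (\sum_(x < W) g x) / W%:R)) => [|x _]; last exact: IH.
by rewrite sumr_const card_ord -[X in X / _]mulr_natr mulfK.
Qed.

(** The words between the picked ones average out, which leaves [N] independent uniform words. *)
Lemma expect_picks B b N U g : (b < B)%N ->
  expect (B * N + U) (fun s => g (picks B b N s)) = expect N g.
Proof.
move=> bB; elim: N g => [|N IH] g /=; first by rewrite expect_const.
rewrite mulnS -addnA expect_cat.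
apply: etrans (expect_nth (fun x => expect N (fun s => g (x :: s))) bB).
apply: eq_expect => s sB _; rewrite -IH; apply: eq_expect => t _ _.
by rewrite nth_cat sB bB drop_cat sB ltnn subnn drop0.
Qed.

Lemma expect_drop T U g : expect (T + U) (fun s => g (drop T s)) = expect U g.
Proof.
rewrite expect_cat -[RHS](expect_const T); apply: eq_expect => s sT _.
by apply: eq_expect => t _ _; rewrite drop_cat sT ltnn subnn drop0.
Qed.

Lemma card_tuple_expect T (P : pred (seq nat)) :
  #|[set t : T.-tuple 'I_W | P [seq val x | x <- t]]|%:R / #|{: T.-tuple 'I_W}|%:R
  = expect T (fun s => (P s)%:R).
Proof.
rewrite card_tuple card_ord; elim: T P => [|T IH] P /=.
  rewrite expn0 divr1 (_ : [set t : 0.-tuple _ | _] = if P [::] then setT else set0).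
    by case: (P [::]); rewrite ?cardsT ?card_tuple ?expn0 ?cards0.
  by apply/setP => t; rewrite !inE tuple0 /=; case: (P [::]); rewrite inE.
rewrite expnS natrM invfM mulrA mulrAC; congr (_ / _).
rewrite -sum1dep_card natr_sum big_mkcond /=.
rewrite (reindex (fun p : 'I_W * T.-tuple 'I_W => [tuple of p.1 :: p.2])) /=; last first.
  exists (fun t => (thead t, [tuple of behead t])).
    by case=> x t _; congr (_, _); apply/val_inj.
  by move=> t _; rewrite [RHS](tuple_eta t); apply/val_inj.
rewrite -(pair_bigA _ (fun x (t : T.-tuple 'I_W) =>
  if P (val x :: [seq val y | y <- t]) then 1 else 0)) /=.
rewrite mulr_suml; apply: eq_bigr => x _; rewrite -IH; congr (_ / _).
by rewrite -sum1dep_card natr_sum [RHS]big_mkcond.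
Qed.

End Expectation.

Lemma success_probE (R : realType) w P input T (good : seq nat -> Prop) :
  success_prob R w P input T good =
  expect (2 ^ w) T (fun s =>
    (halted P (run w P input s) && `[< good (out (run w P input s)) >])%:R%R : R).
Proof. by rewrite -card_tuple_expect ?expn_gt0. Qed.

(** The numbers below [W] contain [W %/ r] complete periods of residues modulo [r]. *)
Lemma card_periodic (W r : nat) (P : pred nat) : 0 < r ->
  (W %/ r) * #|[set i : 'I_r | P i]| <= #|[set x : 'I_W | P (x %% r)]|.
Proof.
move=> r0.
have cardE m (Q : pred nat) : #|[set i : 'I_m | Q i]| = \sum_(0 <= i < m) Q i.
  by rewrite -sum1dep_card big_mkcond big_mkord; apply: eq_bigr => i _; case: (Q i).
rewrite cardE (cardE W (fun x => P (x %% r))).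
rewrite [X in _ <= X](big_cat_nat (n := W %/ r * r)) ?leq_trunc_div //=.
apply: leq_trans (leq_addr _ _); elim: (W %/ r) => [|m IH]; first by rewrite mul0n.
rewrite [X in _ <= X](big_cat_nat (n := m * r)) ?leq_mul2r ?leqnSn ?orbT //=.
have -> : \sum_(m * r <= i < m.+1 * r) P (i %% r) = \sum_(0 <= i < r) P i.
  rewrite mulSn -{1}[m * r]add0n big_addn addnK.
  by apply: eq_big_nat => i /andP[_ ir]; rewrite addnC modnMDl modn_small.
by rewrite mulSn addnC leq_add2r.
Qed.

(** * Union bound over pairs and rounds *)

Section FailureProbability.
Variables (R : realType) (V : finType) (e : rel V) (x0 : V) (q W : nat).
Hypothesis W_gt0 : (0 < W)%N.
Hypothesis q_gt1 : (1 < q)%N.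
Local Open Scope ring_scope.

(** A word hits [D] with probability at least delta / (2 |A|), and 1 - t <= exp(-t). *)
Lemma miss_prob (A : seq V) (delta : nat) (D : {set V}) : uniq A ->
  {subset D <= A} -> (delta < #|D|)%N -> (size A <= W)%N ->
  #|[set x : 'I_W | nth x0 A (x %% size A) \notin D]|%:R / W%:R
    <= expR (- (delta%:R / (2 * (size A)%:R))) :> R.
Proof.
move=> uA DA dD AW.
have A0 : (0 < size A)%N.
  have /card_gt0P[x /DA] : (0 < #|D|)%N by exact: leq_ltn_trans dD.
  by case: (A).
have hits : ((W %/ size A) * #|D| <= #|[set x : 'I_W | nth x0 A (x %% size A) \in D]|)%N.
  apply: leq_trans (card_periodic W (fun i => nth x0 A i \in D) A0).
  rewrite leq_mul2l; apply/orP; right.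
  rewrite -(card_in_imset (f := fun i : 'I_(size A) => nth x0 A i)).
    apply/subset_leq_card/subsetP => x xD; apply/imsetP.
    have ix : (index x A < size A)%N by rewrite index_mem DA.
    by exists (Ordinal ix); rewrite ?inE /= nth_index ?DA.
  move=> i j _ _ /eqP; rewrite nth_uniq // => /eqP; exact: val_inj.
have card_miss : (#|[set x : 'I_W | nth x0 A (x %% size A) \notin D]| +
   #|[set x : 'I_W | nth x0 A (x %% size A) \in D]| = W)%N.
  rewrite -[RHS]card_ord -(cardsC [set x : 'I_W | nth x0 A (x %% size A) \in D]).
  by rewrite addnC; congr (_ + _)%N; apply: eq_card => x; rewrite !inE.
(* As [size A <= W], there is a complete period, and the incomplete last one at most doubles the
   total. *)
have WA : (W <= 2 * size A * (W %/ size A))%N.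
  rewrite {1}(divn_eq W (size A)); have := ltn_pmod W A0.
  have : (0 < W %/ size A)%N by rewrite divn_gt0.
  by move=> ? ?; nia.
have key : (W * delta <= 2 * size A * #|[set x : 'I_W | nth x0 A (x %% size A) \in D]|)%N.
  apply: leq_trans (leq_mul WA (ltnW dD)) _.
  by rewrite -mulnA leq_mul2l hits orbT.
apply: le_trans (expR_ge1Dx _).
set h := #|_|%N in key card_miss hits; set m := #|_|%N in card_miss *.
have mE : m%:R = W%:R - h%:R :> R by rewrite -card_miss natrD addrK.
have {}key : W%:R * delta%:R <= 2 * (size A)%:R * h%:R :> R.
  by rewrite -!natrM ler_nat.
rewrite ler_pdivrMr ?ltr0n // mE mulrDl mul1r mulNr lerD2l lerN2 mulrAC.
by rewrite ler_pdivrMr ?mulr_gt0 ?ltr0n // mulrC [leRHS]mulrC.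
Qed.

Hypothesis halves : forall A ws,
  (0 < size A %/ q)%N -> (2 * size (survivors e x0 q A ws) <= size A)%N.

(** The 4 collects a factor 2 from [miss_prob] and another from [size A <= 2 * q * k], where
    [k = size A %/ q] is the size of the sample. *)
Definition round_failure_bound (delta : nat) : R :=
  (#|V| ^ 2)%:R * expR (- (delta%:R / (4 * q%:R))).

Lemma same_trace_sample A ws u v : same_trace e (sample x0 A ws) u v =
  all (fun x => nth x0 A (x %% size A) \notin
                [set y | e y u != e y v]) ws.
Proof.
by rewrite /same_trace all_map; apply: eq_all => x; rewrite /= inE negbK.
Qed.

Lemma round_fails_prob A delta : uniq A -> (size A <= W)%N ->
  (0 < size A %/ q)%N ->
  expect W (size A %/ q) (fun s => (round_fails e x0 delta A s)%:R)
    <= round_failure_bound delta.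
Proof.
move=> uA AW k0; set k := (size A %/ q)%N in k0 *.
have A0 : (0 < size A)%N by move: k0; rewrite /k; case: (size A); rewrite ?div0n.
pose g (p : V * V) s : R := ([&& p.1 \in A, p.2 \in A,
  (delta < #|diff_set e [set x in A] p.1 p.2|)%N
  & same_trace e (sample x0 A s) p.1 p.2])%:R.
have g_ge0 p s : 0 <= g p s by exact: ler0n.
apply: (@le_trans _ _ (expect W k (fun s => \sum_p g p s))).
  apply: le_expect => // s _ _; case: (boolP (round_fails _ _ _ _ _)) => [|_]; last first.
    by rewrite sumr_ge0.
  move=> /exists_inP[u uA' /exists_inP[v vA' /andP[uv st]]].
  rewrite (bigD1 (u, v)) //= {1}/g /= uA' vA' uv st.
  by rewrite lerDl sumr_ge0.
rewrite expect_sum; apply: (@le_trans _ _ (\sum_(p : V * V)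
    expR (- (delta%:R / (4 * q%:R))))); last first.
  by rewrite sumr_const card_prod /round_failure_bound mulnn [leRHS]mulr_natl.
apply: ler_sum => -[u v] _; rewrite /g /=.
have [/and3P[uA' vA' uv]|h] := boolP [&& u \in A, v \in A &
    (delta < #|diff_set e [set x in A] u v|)%N]; last first.
  rewrite (eq_expect (h := fun=> 0)) ?expect_const ?expR_ge0 // => s _ _.
  by move: h; rewrite !andbA; case: (_ && _) => //=.
set D := diff_set _ _ _ _ in uv.
rewrite (eq_expect (h := fun s => (all (fun x =>
    nth x0 A (x %% size A) \notin D) s)%:R)) // => [|s _ _]; last first.
  rewrite uA' vA' uv same_trace_sample; congr (_%:R); congr nat_of_bool.
  by apply: eq_all => x; rewrite !inE mem_nth // ltn_mod.
rewrite expect_all //.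
apply: (@le_trans _ _ (expR (- (delta%:R / (2 * (size A)%:R))) ^+ k)).
  by rewrite lerXn2r ?nnegrE ?divr_ge0 ?expR_ge0 // miss_prob // => x; rewrite !inE => /andP[].
rewrite -expRM_natl ler_expR mulrN lerN2.
have Ak : (size A <= 2 * q * k)%N.
  rewrite {1}(divn_eq (size A) q) -/k; have := ltn_pmod (size A) (ltnW q_gt1).
  by move=> ?; nia.
have {}Ak : (size A)%:R <= 2 * q%:R * k%:R :> R by rewrite -!natrM ler_nat.
rewrite mulrCA ler_wpM2l // ler_pdivlMr ?mulr_gt0 ?ltr0n ?(ltnW q_gt1) //.
rewrite mulrC ler_pdivrMr ?mulr_gt0 ?ltr0n ?(ltnW q_gt1) //.
nra.
Qed.

(** Once the words of the first round are fixed, the survivors are a fixed list and the other words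
    are fresh, so an induction hypothesis uniform in [A] applies. *)
Lemma fails_prob delta fuel A N : uniq A -> (size A <= W)%N -> (size A <= N)%N ->
  expect W N (fun s => (fails e x0 q delta fuel A s)%:R)
    <= fuel%:R * round_failure_bound delta.
Proof.
have bound_ge0 : 0 <= round_failure_bound delta by rewrite mulr_ge0 ?expR_ge0.
elim: fuel A N => [|fuel IH] A N uA AW AN /=; first by rewrite expect_const ?mul0r.
have k_le : (size A %/ q <= N)%N by apply: leq_trans AN; exact: leq_div.
case Ek: (size A %/ q)%N => [|k]; first by rewrite expect_const // mulr_ge0.
have k0 : (0 < size A %/ q)%N by rewrite Ek.
rewrite -Ek -(subnKC k_le) expect_cat //.
apply: (@le_trans _ _ (expect W (size A %/ q) (fun s =>
   (round_fails e x0 delta A s)%:R + fuel%:R * round_failure_bound delta))).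
  apply: le_expect => // s sk sW.
  have takeE t : take (size A %/ q) (s ++ t) = s by rewrite take_cat sk ltnn subnn take0 cats0.
  apply: (@le_trans _ _ (expect W (N - size A %/ q) (fun t =>
    (round_fails e x0 delta A s)%:R +
    (fails e x0 q delta fuel (survivors e x0 q A s) t)%:R))).
    apply: le_expect => // t _ _.
    rewrite takeE drop_cat sk ltnn subnn drop0 /survivors takeE.
    rewrite (take_oversize (s := s)) ?sk //.
    by case: (round_fails _ _ _ _ _) => /=; rewrite ?add0r // lerDl ler0n.
  rewrite expectD expect_const // lerD2l; apply: IH.
  - exact: reps_uniq.
  - by apply: leq_trans AW; apply: leq_trans (halves s k0); exact: leq_pmull.
  - have hk : (2 * (size A %/ q) <= size A)%N.
      by rewrite mulnC (leq_trans _ (leq_trunc_div (size A) q)) // leq_mul2l q_gt1 orbT.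
    rewrite leq_subRL // -(leq_pmul2l (isT : (0 < 2)%N)) mulnDr.
    apply: leq_trans (leq_add hk (halves s k0)) _.
    by rewrite addnn -mul2n leq_mul2l.
rewrite expectD expect_const // mulrSr mulrDl mul1r addrC lerD2l.
exact: round_fails_prob.
Qed.

End FailureProbability.

(** * The program *)

Section Machine.
Variables (w W : nat) (P : program).
Hypothesis WE : 2 ^ w = W.

(** The configuration reached is chosen before the tape: this suits the deterministic part of the
    execution, after the random words have been stored. *)
Definition leads (c : config) (b : nat) (Q : config -> Prop) : Prop :=
  exists2 t, t <= b & exists2 c', Q c' &
    forall tape, size tape = t -> foldl (step w P) c tape = c'.

Definition state (p : nat) (L : seq nat) (M : nat -> nat) (o : seq nat) : config :=
  Config p (nth 0 L) M o.

Lemma leads_now c b (Q : config -> Prop) : Q c -> leads c b Q.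
Proof. by move=> Qc; exists 0 => //; exists c => // tape /size0nil ->. Qed.

Lemma leads_mono c b b' (Q Q' : config -> Prop) : leads c b Q -> b <= b' ->
  (forall c', Q c' -> Q' c') -> leads c b' Q'.
Proof.
move=> [t tb [c' Qc' h]] bb' QQ'; exists t; first exact: leq_trans bb'.
by exists c' => //; exact: QQ'.
Qed.

Lemma leads_bind c b1 b2 (Q1 Q2 : config -> Prop) : leads c b1 Q1 ->
  (forall c', Q1 c' -> leads c' b2 Q2) -> leads c (b1 + b2) Q2.
Proof.
move=> [t1 tb1 [c1 Qc1 h1]] /(_ _ Qc1)[t2 tb2 [c2 Qc2 h2]].
exists (t1 + t2); first exact: leq_add.
exists c2 => // tape st; rewrite -(cat_take_drop t1 tape) foldl_cat.
rewrite h1 ?h2 // ?size_drop ?size_takel ?st ?leq_addr // addKn //.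
Qed.

Lemma leads_step c c1 b (Q : config -> Prop) :
  (forall x, step w P c x = c1) -> leads c1 b Q -> leads c b.+1 Q.
Proof.
move=> h [t tb [c' Qc' h']]; exists t.+1 => //; exists c' => // -[//|x tape] [st] /=.
by rewrite h; apply: h'.
Qed.

Lemma run_step c c1 x tape c' : step w P c x = c1 ->
  foldl (step w P) c1 tape = c' -> foldl (step w P) c (x :: tape) = c'.
Proof. by move=> /= -> ->. Qed.

Lemma eta_nth (L : seq nat) i v :
  [eta nth 0 L with i |-> v] = nth 0 (set_nth 0 L i v) :> (nat -> nat).
Proof. by apply/funext => x; rewrite nth_set_nth. Qed.

Section Instructions.
Variables (p : nat) (L : seq nat) (M : nat -> nat) (o : seq nat).

Lemma step_arith op i j k v x :
  nth Halt P p = Arith op i j k -> eval_binop op (nth 0 L j) (nth 0 L k) = v ->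
  v < W -> step w P (state p L M o) x = state p.+1 (set_nth 0 L i v) M o.
Proof. by move=> Pp <- vW; rewrite /= /cur_instr Pp eta_nth WE modn_small. Qed.

Lemma step_const i a v x : nth Halt P p = Const i a -> a %% W = v ->
  step w P (state p L M o) x = state p.+1 (set_nth 0 L i v) M o.
Proof. by move=> Pp <-; rewrite /= /cur_instr Pp eta_nth WE. Qed.

Lemma step_fetch i j v x : nth Halt P p = Fetch i j -> M (nth 0 L j) = v ->
  v < W -> step w P (state p L M o) x = state p.+1 (set_nth 0 L i v) M o.
Proof. by move=> Pp <- vW; rewrite /= /cur_instr Pp eta_nth WE modn_small. Qed.

Lemma step_rand i x : nth Halt P p = Rand i -> x < W ->
  step w P (state p L M o) x = state p.+1 (set_nth 0 L i x) M o.
Proof. by move=> Pp xW; rewrite /= /cur_instr Pp eta_nth WE modn_small. Qed.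

Lemma step_store i j M' x : nth Halt P p = Store i j ->
  [eta M with nth 0 L i |-> nth 0 L j] = M' :> (nat -> nat) ->
  step w P (state p L M o) x = state p.+1 L M' o.
Proof. by move=> Pp <-; rewrite /= /cur_instr Pp. Qed.

Lemma step_jlt i j l x : nth Halt P p = Jlt i j l ->
  step w P (state p L M o) x =
  state (if nth 0 L i < nth 0 L j then l else p.+1) L M o.
Proof. by move=> Pp; rewrite /= /cur_instr Pp. Qed.

Lemma step_jmp l x : nth Halt P p = Jmp l ->
  step w P (state p L M o) x = state l L M o.
Proof. by move=> Pp; rewrite /= /cur_instr Pp. Qed.

Lemma step_out i x : nth Halt P p = Out i ->
  step w P (state p L M o) x = state p.+1 L M (rcons o (nth 0 L i)).
Proof. by move=> Pp; rewrite /= /cur_instr Pp. Qed.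

End Instructions.

End Machine.

Definition zero_array : nat -> nat := fun=> 0.

(* Beyond the input, which ends at B, the memory holds interleaved arrays: entry i
   of array j is at address B + 8 i + j.  The program uses, in this order:
   - cls, the class of each vertex in the current round;
   - al, the list of the remaining vertices;
   - mk, the end of the last sample containing each vertex;
   - st, the position of the last sampled vertex that split each class;
   - nw, the class into which that vertex moved its neighbours;
   - rp, the representative of each class plus 1, or 0;
   - wd, the random words. *)
Definition layout (B : nat) (inp : nat -> nat) (Fs : seq (nat -> nat)) (a : nat) : nat :=
  if a < B then inp a else nth zero_array Fs ((a - B) %% 8) ((a - B) %/ 8).

Lemma layout_inp B inp Fs a : a < B -> layout B inp Fs a = inp a.
Proof. by rewrite /layout => ->. Qed.

Lemma layout_get B inp Fs i j : j < 8 ->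
  layout B inp Fs (i * 8 + (B + j)) = nth zero_array Fs j i.
Proof.
move=> j8; rewrite /layout addnCA ltnNge leq_addr /= addKn.
by rewrite modnMDl divnMDl // modn_small // divn_small // addn0.
Qed.

Lemma layout_set B inp Fs i j v : j < 8 ->
  [eta layout B inp Fs with i * 8 + (B + j) |-> v] =
  layout B inp (set_nth zero_array Fs j [eta nth zero_array Fs j with i |-> v])
    :> (nat -> nat).
Proof.
move=> j8; apply/funext => a /=; have [->|aE] := eqVneq a (i * 8 + (B + j)).
  by rewrite layout_get // nth_set_nth /= eqxx /= eqxx.
rewrite /layout; case: ltnP => // Ba; rewrite nth_set_nth /=.
case: eqP => [j_eq|//] /=; case: eqP => [i_eq|_]; last by rewrite j_eq.
by case/eqP: aE; rewrite -i_eq -j_eq addnCA -divn_eq subnKC.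
Qed.

(* n is the number of vertices, q the divisor of the program, r the number of
   remaining vertices, fr the first unused class, p the number of words used, pe
   its value at the end of the round and pp = p + 1; the other variables are
   scratch registers.  The last register is never written. *)
Notation registers n B q r fr p pe i x a ae t u s y j pp :=
  [:: n; 1; 8; B + 0; B + 1; B + 2; B + 3; B + 5; B + 6; q; r; fr; p; pe; i; x;
      a; ae; t; u; s; y; j; pp; 0].

(** Register 24 serves as the constant 0. Only [cls] is reset in a round. The stamps in [mk] and
    [st] are positions in the word list, which increase, so old stamps become stale by themselves;
    class numbers are never reused, so [rp] needs no clearing. *)
Definition prog (lq : nat) : program := [::
     Fetch 0 24; Const 1 1; Const 2 8; Const 18 2; Arith Add 18 18 0;
     Fetch 3 18; Arith Add 4 3 1; Arith Add 5 4 1; Arith Add 6 5 1;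
     Arith Add 7 6 1; Arith Add 7 7 1; Arith Add 8 7 1; Const 9 (2 ^ lq);
     (* 13: store vertex i and draw word i, at a time independent of the tape *)
     Arith Mul 18 14 2; Arith Add 19 18 4; Store 19 14; Arith Add 18 18 8;
     Rand 19; Store 18 19; Arith Add 14 14 1; Jlt 14 0 13; Arith Add 10 0 24;
     Arith Add 11 1 24;
     (* 23: start a round, if r >= 2 ^ lq *)
     Arith Div 19 10 9; Jlt 24 19 26; Jmp 102;
     Arith Add 13 12 19; Arith Add 14 24 24;
     (* 28: put every vertex into the same class *)
     Arith Mul 18 14 2; Arith Add 18 18 3; Store 18 11; Arith Add 14 14 1;
     Jlt 14 0 28; Arith Add 11 11 1;
     (* 34: draw the next vertex x of the sample *)
     Arith Mul 18 12 2; Arith Add 18 18 8; Fetch 19 18; Arith Mod 19 19 10;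
     Arith Mul 18 19 2; Arith Add 18 18 4; Fetch 15 18; Arith Mul 18 15 2;
     Arith Add 18 18 5; Fetch 19 18; Jlt 19 13 46; Jmp 74;
     (* 46: x is drawn for the first time in this round *)
     Store 18 13; Arith Add 18 15 1; Arith Add 18 18 1; Fetch 16 18;
     Arith Add 18 18 1; Fetch 17 18; Arith Add 23 12 1;
     (* 53: split the classes by the neighbours of x *)
     Jlt 16 17 55; Jmp 74;
     Fetch 21 16; Arith Mul 18 21 2; Arith Add 18 18 3; Fetch 19 18;
     Arith Mul 20 19 2; Arith Add 20 20 6; Fetch 19 20; Jlt 19 23 67;
     Arith Add 20 20 1; Fetch 19 20; Store 18 19; Jmp 72;
     (* 67: first neighbour of x met in its class *)
     Store 20 23; Arith Add 20 20 1; Store 20 11; Store 18 11;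
     Arith Add 11 11 1;
     Arith Add 16 16 1; Jmp 53;
     Arith Add 12 12 1; Jlt 12 13 34; Arith Add 14 24 24; Arith Add 22 24 24;
     (* 78: keep the first vertex of each class *)
     Arith Mul 18 14 2; Arith Add 18 18 4; Fetch 21 18; Arith Mul 18 21 2;
     Arith Add 18 18 3; Fetch 19 18; Arith Mul 18 19 2; Arith Add 18 18 7;
     Fetch 19 18; Jlt 24 19 95; Arith Add 19 21 1; Store 18 19;
     Arith Mul 18 22 2; Arith Add 18 18 4; Store 18 21; Arith Add 22 22 1;
     Jmp 98;
     (* 95: output a vertex and its representative *)
     Out 21; Arith Defs.Sub 19 19 1; Out 19;
     Arith Add 14 14 1; Jlt 14 10 78; Arith Add 10 22 24; Jmp 23;
     (* 102: pair the remaining vertices with the first one *)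
     Arith Add 14 1 24; Fetch 15 4;
     Jlt 14 10 106; Halt;
     Arith Mul 18 14 2; Arith Add 18 18 4; Fetch 21 18; Out 21; Out 15;
     Arith Add 14 14 1; Jmp 104].

(** * Partition refinement by a neighbourhood *)

Section Refinement.
Variables (n : nat) (e : rel 'I_n) (adj : 'I_n -> seq 'I_n).
Hypothesis adjP : adjacency_lists e adj.

(** [lo] is the first class number of the round; the entries of [rp] from [lo] on are still 0 when
    the round starts. *)
Definition classifies (lo : nat) (xs : seq 'I_n) (cls : nat -> nat) (fr : nat) : Prop :=
  (forall u v : 'I_n, (cls u == cls v) = same_trace e xs u v) /\
  (forall u : 'I_n, lo <= cls u < fr).

(* Classes are being split by the neighbourhood of a vertex, of which ys has been
   scanned; the class c goes to nw c when st c carries the current stamp pp. *)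
Record splitting (cls0 : nat -> nat) (fr0 pp : nat) (ys : seq 'I_n)
    (cls st nw : nat -> nat) (fr : nat) : Prop := Splitting {
  split_out : forall u : 'I_n, u \notin ys -> cls u = cls0 u;
  split_in : forall u : 'I_n, u \in ys -> cls u = nw (cls0 u) /\ st (cls0 u) = pp;
  split_new : forall c, st c = pp -> c < fr0 /\ fr0 <= nw c < fr;
  split_inj : forall c c', st c = pp -> st c' = pp -> nw c = nw c' -> c = c';
  split_le : forall c, st c <= pp;
  split_fr : fr0 <= fr <= fr0 + size ys
}.

Lemma splitting_start cls0 fr0 pp st nw : (forall c, st c < pp) ->
  splitting cls0 fr0 pp [::] cls0 st nw fr0.
Proof.
move=> lt_st; have neq_st c : st c <> pp by have := lt_st c; lia.
by split=> //= [c /neq_st|c c' /neq_st|c|]; rewrite ?addn0 ?leqnn // ltnW.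
Qed.

Section Step.
Variables (cls0 cls st nw : nat -> nat) (fr0 fr pp : nat) (ys : seq 'I_n).
Variable y : 'I_n.
Hypothesis cls0_lt : forall u : 'I_n, cls0 u < fr0.
Hypothesis split_ys : splitting cls0 fr0 pp ys cls st nw fr.
Hypothesis y_notin : y \notin ys.

Lemma splitting_old : st (cls y) = pp ->
  splitting cls0 fr0 pp (rcons ys y) [eta cls with val y |-> nw (cls y)] st nw fr.
Proof.
case: split_ys => h_out h_in h_new h_inj h_le /andP[f1 f2] st_y; split=> //.
- move=> u; rewrite mem_rcons inE negb_or => /andP[uy /h_out <-] /=.
  by rewrite (inj_eq val_inj) (negbTE uy).
- move=> u; rewrite mem_rcons inE /= (inj_eq val_inj).
  have [->|_ /= /h_in //] := eqVneq u y.
  by rewrite -(h_out _ y_notin).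
- by rewrite size_rcons addnS f1 leqW.
Qed.

Lemma splitting_fresh : st (cls y) < pp ->
  splitting cls0 fr0 pp (rcons ys y) [eta cls with val y |-> fr]
    [eta st with cls y |-> pp] [eta nw with cls y |-> fr] fr.+1.
Proof.
case: split_ys => h_out h_in h_new h_inj h_le /andP[f1 f2] st_y.
have cy := h_out _ y_notin.
split.
- move=> u; rewrite mem_rcons inE negb_or => /andP[uy /h_out <-] /=.
  by rewrite (inj_eq val_inj) (negbTE uy).
- move=> u; rewrite mem_rcons inE /= (inj_eq val_inj).
  have [->|_ /= /h_in [cu su]] := eqVneq u y; first by rewrite cy eqxx.
  rewrite cu su; case: eqP => // cuy.
  by move: st_y; rewrite -cuy su ltnn.
- move=> c /=; case: eqP => [->|_ /h_new]; last by lia.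
  by rewrite cy cls0_lt f1 ltnSn.
- move=> c c' /=; case: eqP => [->|_]; case: eqP => [->|_] //.
  + by move=> _ /h_new; lia.
  + by move=> /h_new; lia.
  + exact: h_inj.
- by move=> c /=; case: eqP.
- by rewrite size_rcons addnS ltnS f2 leqW.
Qed.

End Step.

(** Neighbours of [x] now carry numbers from [fr0] on, different for different old classes; the
    other vertices keep theirs, below [fr0]. A class contained in [adj x] is merely renumbered. *)
Lemma splitting_end lo xs x cls0 cls st nw fr0 fr pp : classifies lo xs cls0 fr0 ->
  splitting cls0 fr0 pp (adj x) cls st nw fr -> classifies lo (rcons xs x) cls fr.
Proof.
move=> [eq0 lt0] [h_out h_in h_new h_inj h_le f12].
have mem_adj u : (u \in adj x) = e x u by rewrite (perm_mem (adjP x)) mem_enum.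
have case_u u : if e x u then [/\ cls u = nw (cls0 u), st (cls0 u) = pp,
    fr0 <= cls u & cls u < fr] else cls u = cls0 u /\ cls u < fr0.
  case: ifP => xu; last by rewrite h_out ?mem_adj ?xu //; case/andP: (lt0 u).
  have [cu su] : cls u = nw (cls0 u) /\ st (cls0 u) = pp by apply: h_in; rewrite mem_adj.
  by have := h_new _ su; rewrite cu => -[_ /andP[]].
split=> [u v|u]; last by have := case_u u; have := lt0 u; case: ifP => _ + []; lia.
rewrite /same_trace all_rcons -/(same_trace e xs u v) -eq0.
have := case_u u; have := case_u v; case: (e x u); case: (e x v) => /=.
- move=> [-> sv _ _] [-> su _ _]; apply/eqP/eqP => [|-> //]; exact: h_inj.
- by move=> [_ ?] [_ _ ? _]; apply/eqP; lia.
- by move=> [_ _ ? _] [_ ?]; apply/eqP; lia.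
- by move=> [-> _] [-> _].
Qed.

Lemma classifies_again lo xs x cls fr : classifies lo xs cls fr -> x \in xs ->
  classifies lo (rcons xs x) cls fr.
Proof.
move=> [eq0 lt0] xxs; split=> // u v; rewrite eq0 /same_trace all_rcons.
by case: (boolP (all _ xs)) => [/allP /(_ _ xxs) ->|_]; rewrite ?andbF.
Qed.

Lemma classifies_nil (cls : nat -> nat) fr : (forall u : 'I_n, cls u = fr) ->
  classifies fr [::] cls fr.+1.
Proof. by move=> h; split=> [u v|u]; rewrite !h ?eqxx ?leqnn. Qed.

End Refinement.

(** The same tactics run the program under [leads] and, in the prelude, along an explicit tape. *)
Ltac do_step lem := (eapply leads_step; [move=> ?; lem | ]) || (eapply run_step; [lem | ]).

Ltac arith val :=
  do_step ltac:(eapply step_arith with (v := val);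
    [eassumption | reflexivity
    | cbn [nth eval_binop]; first [reflexivity | lia | idtac] | first [lia | done]]);
  cbn [set_nth].

Ltac const val :=
  do_step ltac:(eapply step_const with (v := val);
    [eassumption | reflexivity | first [reflexivity | by rewrite modn_small; [|lia]]]);
  cbn [set_nth].

Ltac fetch val :=
  do_step ltac:(eapply step_fetch with (v := val);
    [eassumption | reflexivity
    | cbn [nth]; first [by rewrite layout_get | by rewrite layout_inp; [|lia] | idtac]
    | try lia]);
  cbn [set_nth].

Ltac rand := do_step ltac:(eapply step_rand; [eassumption | reflexivity | try lia]);
  cbn [set_nth].

Ltac store :=
  do_step ltac:(eapply step_store; [reflexivity | cbn [nth]; by rewrite layout_set]);
  cbn [nth set_nth].

Ltac jlt := do_step ltac:(eapply step_jlt; reflexivity); cbn [nth].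

Ltac jmp := do_step ltac:(eapply step_jmp; reflexivity).

Ltac output := do_step ltac:(eapply step_out; reflexivity); cbn [nth].

(** * Correctness and running time of the program *)

Section Program.
Variables (w W lq n B Z : nat) (e : rel 'I_n) (adj : 'I_n -> seq 'I_n) (x0 : 'I_n).
Variables (inp off : nat -> nat) (ws : seq nat).
Hypothesis WE : 2 ^ w = W.
Hypothesis ZW : B + 8 * Z + 16 <= W.
Hypothesis nZ : n <= Z.
Hypothesis adjP : adjacency_lists e adj.
Hypothesis inp_off : forall x, x <= n -> inp x.+2 = off x.
Hypothesis off_succ : forall x : 'I_n, off x.+1 = off x + size (adj x).
Hypothesis off_le : forall x, x <= n -> off x <= B.
Hypothesis off_n : off n = B.
Hypothesis inp_adj : forall (x : 'I_n) j, j < size (adj x) ->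
  inp (off x + j) = nth x0 (adj x) j.
Hypothesis n_B : n + 3 <= B.

Local Notation qq := (2 ^ lq %% W).
Local Notation P := (prog lq).

Lemma edge_loop (x : 'I_n) (cls0 : nat -> nat) fr0 p pe r al mk rp wd o i jj :
  (forall u : 'I_n, cls0 u < fr0) -> fr0 + size (adj x) <= Z -> p < n ->
  forall N j (cls st nw : nat -> nat) fr t u s y,
  size (adj x) = j + N ->
  splitting cls0 fr0 p.+1 (take j (adj x)) cls st nw fr ->
  (forall c, nw c < W) ->
  leads w P
    (state 53 (registers n B qq r fr p pe i (nat_of_ord x) (off x + j) (off x.+1) t u s y jj p.+1)
       (layout B inp [:: cls; al; mk; st; nw; rp; wd]) o)
    (20 * N + 2)
    (fun c => exists cls' st' nw' fr' a t u s y,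
       [/\ c = state 74
         (registers n B qq r fr' p pe i (nat_of_ord x) a (off x.+1) t u s y jj p.+1)
         (layout B inp [:: cls'; al; mk; st'; nw'; rp; wd]) o,
         splitting cls0 fr0 p.+1 (adj x) cls' st' nw' fr' &
         forall c, nw' c < W]).
Proof.
move=> cls0_lt fr0Z pn; elim=> [|N IH] j cls st nw fr t u s y sz spl nwW.
  jlt; have -> : (off x + j < off x.+1) = false.
    by rewrite off_succ sz addn0 ltnn.
  jmp; apply: leads_now.
  exists cls, st, nw, fr; do 5!eexists; split; [reflexivity| |by []].
  by rewrite take_oversize ?sz ?addn0 in spl.
have jsz : j < size (adj x) by rewrite sz; lia.
have takeS : take j.+1 (adj x) = rcons (take j (adj x)) (nth x0 (adj x) j).
  by rewrite (take_nth x0).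
have uniq_adj : uniq (adj x) by rewrite (perm_uniq (adjP x)) enum_uniq.
set y' := nth x0 (adj x) j in takeS.
have y'_notin : y' \notin take j (adj x).
  by have := take_uniq j.+1 uniq_adj; rewrite takeS rcons_uniq => /andP[].
have off_B : off x + size (adj x) <= B by rewrite -off_succ; exact: off_le.
have fr_le : fr0 <= fr <= fr0 + j.
  by have := split_fr spl; rewrite size_take jsz.
have cls_y : cls y' < fr0 by rewrite (split_out spl).
rewrite (_ : 20 * N.+1 + 2 = 20 + (20 * N + 2)); last lia.
have y'n := ltn_ord y'.
jlt; have -> : off x + j < off x.+1 by rewrite off_succ ltn_add2l.
fetch (nat_of_ord y'); first by rewrite layout_inp ?inp_adj //; lia.
arith (y' * 8). arith (y' * 8 + (B + 0)).
fetch (cls y').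
arith (cls y' * 8). arith (cls y' * 8 + (B + 3)).
have st_y := split_le spl (cls y').
fetch (st (cls y')).
jlt. case: ltnP => [st_lt|st_ge].
  store. arith (cls y' * 8 + (B + 4)). store. store.
  arith fr.+1. arith (off x + j.+1). jmp.
  eapply leads_mono; [eapply IH with (j := j.+1) | lia | by []].
  - by rewrite sz addSnnS.
  - by rewrite takeS; exact: splitting_fresh.
  - by move=> c /=; case: eqP => // _; lia.
arith (cls y' * 8 + (B + 4)). fetch (nw (cls y')); first exact: nwW.
store. jmp.
arith (off x + j.+1). jmp.
eapply leads_mono; [eapply IH with (j := j.+1) | lia | by []].
- by rewrite sz addSnnS.
- by rewrite takeS; apply: splitting_old => //; lia.
- by [].
Qed.

Hypothesis ws_size : size ws = n.
Hypothesis ws_lt : all (fun x => x < W) ws.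

(** Potential of a round: it bounds both the scanning still to be paid for and the classes still to
    be created. A vertex drawn again is recognised by its mark, so each list is scanned at most once
    although sampling is with replacement. *)
Definition degrees_off (xs : seq 'I_n) : nat :=
  \sum_(x | x \notin xs) size (adj x).

Definition new_degree (xs : seq 'I_n) (x : 'I_n) : nat :=
  if x \in xs then 0 else size (adj x).

Lemma degrees_off_rcons xs x :
  degrees_off xs = new_degree xs x + degrees_off (rcons xs x).
Proof.
rewrite /degrees_off /new_degree; case: ifP => xxs.
  apply: eq_bigl => y; rewrite mem_rcons inE negb_or.
  by have [->|//] := eqVneq y x; rewrite xxs.
rewrite (bigD1 x) ?xxs //=; congr addn.
by apply: eq_bigl => y; rewrite mem_rcons inE negb_or andbC.
Qed.

Definition words (wd : nat -> nat) : Prop := forall i, i < n -> wd i = nth 0 ws i.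

Definition lists (al : nat -> nat) (A : seq 'I_n) : Prop :=
  forall i, i < size A -> al i = nth x0 A i.

Lemma sample_step (A xs : seq 'I_n) lo p pe al rp wd o i jj
    (cls mk st nw : nat -> nat) fr x a ae t u s y pp :
  0 < size A <= n -> lists al A -> words wd -> p < pe -> pe <= n ->
  classifies e lo xs cls fr ->
  (forall x : 'I_n, mk x <= pe /\ (mk x == pe) = (x \in xs)) ->
  (forall c, st c <= p) -> (forall c, nw c < W) -> fr + degrees_off xs <= Z ->
  let z := nth x0 A (nth 0 ws p %% size A) in
  let deg := new_degree xs z in
  leads w P
    (state 34 (registers n B qq (size A) fr p pe i x a ae t u s y jj pp)
       (layout B inp [:: cls; al; mk; st; nw; rp; wd]) o)
    (23 + 20 * deg)
    (fun c => exists (cls' mk' st' nw' : nat -> nat) fr' x a ae t u s y pp,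
       [/\ c = state 74 (registers n B qq (size A) fr' p pe i x a ae t u s y jj pp)
             (layout B inp [:: cls'; al; mk'; st'; nw'; rp; wd]) o,
           classifies e lo (rcons xs z) cls' fr',
           forall x : 'I_n, mk' x <= pe /\ (mk' x == pe) = (x \in rcons xs z),
           forall c, st' c <= p.+1 &
           (forall c, nw' c < W) /\ fr <= fr' <= fr + deg]).
Proof.
move=> /andP[A0 An] alA wdP ppe pen cl_xs mkP stP nwP frZ z deg.
have pn : p < n by exact: leq_trans pen.
have wdp : wd p = nth 0 ws p by exact: wdP.
have ws_p : nth 0 ws p < W by apply: (allP ws_lt); rewrite mem_nth // ws_size.
have zA : nth 0 ws p %% size A < size A by rewrite ltn_mod.
have zn := ltn_ord z.
have [mk_z mk_zE] := mkP z.
arith (p * 8). arith (p * 8 + (B + 6)).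
fetch (nth 0 ws p).
arith (nth 0 ws p %% size A).
arith (nth 0 ws p %% size A * 8).
arith (nth 0 ws p %% size A * 8 + (B + 1)).
fetch (nat_of_ord z); first by rewrite layout_get //= alA.
arith (z * 8). arith (z * 8 + (B + 2)).
fetch (mk z).
jlt; case: ltnP => [mk_lt|mk_ge]; last first.
  have zxs : z \in xs by rewrite -mk_zE; apply/eqP; lia.
  jmp; apply: leads_now; exists cls, mk, st, nw, fr; do 8!eexists; split; first reflexivity.
  - exact: classifies_again.
  - move=> x'; rewrite mem_rcons inE; have [->|_] := eqVneq x' z; last exact: mkP.
    by rewrite mk_zE zxs.
  - by move=> c; rewrite leqW.
  - by rewrite leqnn leq_addr.
have zxs : z \notin xs by rewrite -mk_zE; apply/eqP; lia.
have degE : deg = size (adj z) by rewrite /deg /new_degree (negbTE zxs).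
have frZ' : fr + size (adj z) <= Z.
  by apply: leq_trans frZ; rewrite (degrees_off_rcons xs z) -/deg degE addnA leq_addr.
rewrite degE.
have off_z := off_le (ltnW zn); have off_zS := off_le zn.
store. arith z.+1. arith z.+2.
fetch (off z + 0); first by rewrite layout_inp ?inp_off ?addn0 //; lia.
arith z.+3.
fetch (off z.+1); first by rewrite layout_inp ?inp_off //; lia.
arith p.+1.
eapply leads_mono.
- eapply edge_loop with (j := 0) (N := size (adj z)) (cls0 := cls) (fr0 := fr) => //.
    by move=> v; case: cl_xs => _ /(_ v) /andP[].
  by rewrite take0; apply: splitting_start => c; rewrite ltnS.
- lia.
move=> _ [cls' [st' [nw' [fr' [a' [t' [u' [s' [y' [-> spl nwW]]]]]]]]]].
exists cls', [eta mk with nat_of_ord z |-> pe], st', nw', fr'.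
do 8!eexists; split; first reflexivity.
- exact: splitting_end cl_xs spl.
- move=> x'; rewrite mem_rcons inE /= (inj_eq val_inj).
  by have [_|_] := eqVneq x' z; [rewrite eqxx | exact: mkP].
- exact: split_le spl.
- by split=> //; exact: split_fr spl.
Qed.

Lemma sample_loop (A : seq 'I_n) lo p0 k F al rp wd o i jj :
  0 < size A <= n -> lists al A -> words wd -> p0 + k <= n -> F <= Z ->
  forall N j (cls mk st nw : nat -> nat) fr x a ae t u s y pp,
  k = j + N.+1 ->
  let xs := sample x0 A (take j (drop p0 ws)) in
  classifies e lo xs cls fr ->
  (forall x : 'I_n, mk x <= p0 + k /\ (mk x == p0 + k) = (x \in xs)) ->
  (forall c, st c <= p0 + j) -> (forall c, nw c < W) ->
  fr + degrees_off xs <= F ->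
  leads w P
    (state 34 (registers n B qq (size A) fr (p0 + j) (p0 + k) i x a ae t u s y jj pp)
       (layout B inp [:: cls; al; mk; st; nw; rp; wd]) o)
    (25 * N.+1 + 20 * degrees_off xs)
    (fun c => exists cls' mk' st' nw' fr' x a ae t u s y pp,
       [/\ c = state 76
             (registers n B qq (size A) fr' (p0 + k) (p0 + k) i x a ae t u s y jj pp)
             (layout B inp [:: cls'; al; mk'; st'; nw'; rp; wd]) o,
           classifies e lo (sample x0 A (take k (drop p0 ws))) cls' fr',
           forall x : 'I_n, mk' x <= p0 + k,
           forall c, st' c <= p0 + k &
           (forall c, nw' c < W) /\ fr <= fr' <= F]).
Proof.
move=> /andP[A0 An] alA wdP p0k FZ.
elim=> [|N IH] j cls mk st nw fr x a ae t u s y pp kE xs cl_xs mkP stP nwP frF;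
  pose z := nth x0 A (nth 0 ws (p0 + j) %% size A);
  have degS := degrees_off_rcons xs z;
  (have xsS : sample x0 A (take j.+1 (drop p0 ws)) = @rcons 'I_n xs z
     by rewrite /sample (take_nth 0) ?size_drop ?ws_size ?map_rcons ?nth_drop //; lia);
  (have p_lt : p0 + j < p0 + k by lia);
  have An' : 0 < size A <= n by rewrite A0.
- eapply leads_mono; last by move=> c; exact.
    eapply leads_bind.
      by eapply sample_step with (lo := lo) (xs := xs) => //; lia.
    move=> _ [cls' [mk' [st' [nw' [fr' [x' [a' [ae' [t' [u' [s' [y' [pp'
      [-> cl' mk'P st'P [nw'P fr'P]]]]]]]]]]]]]]].
    arith (p0 + k). jlt; rewrite ltnn.
    apply: (@leads_now _ _ _ 0).
    exists cls', mk', st', nw', fr'; do 8!eexists; split; first reflexivity.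
    + by rewrite kE addn1 xsS.
    + by move=> v; case: (mk'P v).
    + by move=> c; rewrite kE addn1 addnS.
    + by split=> //; move: fr'P; rewrite -/z; lia.
  by rewrite -/z; lia.
eapply leads_mono; last by move=> c; exact.
  eapply leads_bind.
    by eapply sample_step with (lo := lo) (xs := xs) => //; lia.
  move=> _ [cls' [mk' [st' [nw' [fr' [x' [a' [ae' [t' [u' [s' [y' [pp'
    [-> cl' mk'P st'P [nw'P fr'P]]]]]]]]]]]]]]].
  arith (p0 + j.+1). jlt; have -> : p0 + j.+1 < p0 + k by lia.
  eapply leads_mono.
  - eapply IH with (j := j.+1).
    + by rewrite kE addSnnS.
    + by rewrite xsS; exact: cl'.
    + by move=> v; rewrite xsS; exact: mk'P.
    + by move=> c; rewrite addnS; exact: st'P.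
    + exact: nw'P.
    + by rewrite xsS; move: fr'P; rewrite -/z; lia.
  - exact: leqnn.
  move=> _ [cls2 [mk2 [st2 [nw2 [fr2 [x2 [a2 [ae2 [t2 [u2 [s2 [y2 [pp2
    [-> cl2 mk2P st2P [nw2P fr2P]]]]]]]]]]]]]]].
  exists cls2, mk2, st2, nw2, fr2; do 8!eexists; split; [reflexivity | by [] | by [] | by [] | ].
  by split=> //; move: fr'P; lia.
by rewrite xsS -/z; lia.
Qed.

Lemma init_loop r fr p pe al mk st nw rp wd o x a ae u s y jj pp : fr <= Z ->
  forall N i (cls : nat -> nat) t, n = i + N.+1 ->
  (forall v, v < i -> cls v = fr) ->
  leads w P
    (state 28 (registers n B qq r fr p pe i x a ae t u s y jj pp)
       (layout B inp [:: cls; al; mk; st; nw; rp; wd]) o)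
    (5 * N.+1)
    (fun c => exists (cls' : nat -> nat) t,
       c = state 33 (registers n B qq r fr p pe n x a ae t u s y jj pp)
             (layout B inp [:: cls'; al; mk; st; nw; rp; wd]) o /\
       (forall v, v < n -> cls' v = fr)).
Proof.
move=> frZ; elim=> [|N IH] i cls t nE clsP.
  arith (i * 8). arith (i * 8 + (B + 0)). store. arith n. jlt; rewrite ltnn.
  apply: leads_now; do 2!eexists; split; first reflexivity.
  by move=> v vn /=; case: eqP => // vi; apply: clsP; lia.
rewrite (_ : 5 * N.+2 = 5 + 5 * N.+1); last lia.
arith (i * 8). arith (i * 8 + (B + 0)). store. arith i.+1. jlt.
have -> : i.+1 < n by lia.
eapply leads_mono; [eapply IH | lia | by move=> c; exact].
  by rewrite nE addSnnS.
by move=> v vn /=; case: eqP => // vi; apply: clsP; lia.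
Qed.

Definition represents (eqv : rel 'I_n) (acc : seq 'I_n) (cls rp : nat -> nat) : Prop :=
  forall v : 'I_n, rp (cls v) =
    if has (eqv v) acc then (nth v acc (find (eqv v) acc) : nat).+1 else 0.

Lemma represents_rcons eqv acc (cls rp : nat -> nat) (y : 'I_n) :
  (forall u v : 'I_n, (cls u == cls v) = eqv u v) ->
  represents eqv acc cls rp -> ~~ has (eqv y) acc ->
  represents eqv (rcons acc y) cls [eta rp with cls y |-> y.+1].
Proof.
move=> clsE rpP not_y v /=; rewrite clsE -cats1 has_cat find_cat nth_cat /= orbF.
case: ifP => vy.
  have -> : has (eqv v) acc = false.
    apply: negbTE; apply: contra not_y => /hasP[z zacc vz]; apply/hasP; exists z => //.
    by move: vy vz; rewrite -!clsE => /eqP ->.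
  by rewrite /= addn0 ltnn subnn.
by rewrite orbF rpP; case: ifP => // hv; rewrite -has_find hv.
Qed.

Lemma encode_seq_cat (s1 s2 : seq ('I_n * 'I_n)) :
  encode_seq (s1 ++ s2) = encode_seq s1 ++ encode_seq s2.
Proof. by rewrite /encode_seq map_cat flatten_cat. Qed.

Section Group.
Variables (eqv : rel 'I_n) (r fr p pe : nat) (cls mk st nw wd : nat -> nat).
Variables (x a ae s pp : nat).
Hypothesis rn : r <= n.
Hypothesis frZ : fr <= Z.
Hypothesis clsE : forall u v : 'I_n, (cls u == cls v) = eqv u v.
Hypothesis cls_lt : forall u : 'I_n, cls u < fr.

(** Stated with a continuation because the branch that keeps [v] and the one that outputs it join at
    instruction 98. The list is compacted in place: writes go to position [size acc <= i], never to
    an entry still to be read. *)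
Lemma group_step (v : 'I_n) acc i (al rp : nat -> nat) o t u y Q b :
  i < r -> size acc <= i -> al i = v ->
  lists al acc -> represents eqv acc cls rp -> (forall c, fr <= c -> rp c = 0) ->
  (forall al' rp' t u y,
     let acc' := if has (eqv v) acc then acc else rcons acc v in
     let o' := if has (eqv v) acc
       then [:: (v, nth v acc (find (eqv v) acc))] else [::] in
     lists al' acc' -> represents eqv acc' cls rp' ->
     (forall c, fr <= c -> rp' c = 0) ->
     (forall i', i < i' -> al' i' = al i') ->
     leads w P (state 98 (registers n B qq r fr p pe i x a ae t u s y (size acc') pp)
       (layout B inp [:: cls; al'; mk; st; nw; rp'; wd]) (o ++ encode_seq o')) b Q) ->
  leads w P (state 78 (registers n B qq r fr p pe i x a ae t u s y (size acc) pp)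
     (layout B inp [:: cls; al; mk; st; nw; rp; wd]) o) (17 + b) Q.
Proof.
move=> ir acc_i al_i al_acc rpP rp0 cont.
have vn := ltn_ord v; have cls_v := cls_lt v; have rp_v := rpP v.
have rp_W : rp (cls v) < W.
  by rewrite rp_v; case: ifP => _; [have := ltn_ord (nth v acc (find (eqv v) acc))|]; lia.
arith (i * 8). arith (i * 8 + (B + 1)). fetch (nat_of_ord v).
arith (v * 8). arith (v * 8 + (B + 0)). fetch (cls v).
arith (cls v * 8). arith (cls v * 8 + (B + 5)). fetch (rp (cls v)).
jlt; have := cont; case: ifP rp_v rp_W => hv -> rp_W {}cont; last first.
  rewrite ltnn; arith v.+1. store.
  arith (size acc * 8). arith (size acc * 8 + (B + 1)). store.
  arith (size acc).+1. jmp.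
  have := cont [eta al with size acc |-> nat_of_ord v] [eta rp with cls v |-> v.+1].
  rewrite /= size_rcons cats0; apply.
  - move=> i'; rewrite size_rcons ltnS nth_rcons /= => i'_acc.
    case: (ltngtP i' (size acc)) i'_acc => // i'_lt _; exact: al_acc.
  - by apply: represents_rcons => //; rewrite hv.
  - by move=> c frc; case: eqP => [c_v|_]; [lia | exact: rp0].
  - by move=> i' ii'; case: eqP => // i'_acc; lia.
rewrite ltn0Sn; output.
arith (nat_of_ord (nth v acc (find (eqv v) acc))).
output.
eapply leads_mono; [|exact: (leq_addl 4) | by move=> c; exact].
have := cont al rp; rewrite /encode_seq /= -!cats1 -catA; exact.
Qed.

Lemma group_loop (A : seq 'I_n) v acc i (al rp : nat -> nat) o t u y :
  r = i + (size A).+1 -> size acc <= i ->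
  (forall i', i' <= size A -> al (i + i') = nth x0 (v :: A) i') ->
  lists al acc -> represents eqv acc cls rp -> (forall c, fr <= c -> rp c = 0) ->
  leads w P
    (state 78 (registers n B qq r fr p pe i x a ae t u s y (size acc) pp)
       (layout B inp [:: cls; al; mk; st; nw; rp; wd]) o)
    (19 * (size A).+1)
    (fun c => exists (al' rp' : nat -> nat) t u y,
       [/\ c = state 100
             (registers n B qq r fr p pe r x a ae t u s y
                (size (reps eqv acc (v :: A))) pp)
             (layout B inp [:: cls; al'; mk; st; nw; rp'; wd])
             (o ++ encode_seq (merges eqv acc (v :: A))),
           lists al' (reps eqv acc (v :: A)) & forall c, fr <= c -> rp' c = 0]).
Proof.
elim: A v acc i al rp o t u y => [|v' A IH] v acc i al rp o t u y rE acc_i al_rest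
    al_acc rpP rp0; have al_i : al i = v by have := al_rest 0 isT; rewrite addn0.
  apply: (@group_step v) => //; first by lia.
  move=> al' rp' t' u' y' acc' o' al'P rp'P rp'0 al'E.
  move: rE => /= rE; arith r.
  jlt; rewrite ltnn; apply: (@leads_now _ _ _ 0).
  by exists al', rp', t', u', y'.
rewrite (_ : 19 * _ = 17 + (2 + 19 * (size A).+1)); last by rewrite /=; lia.
apply: (@group_step v) => //; first by lia.
move=> al' rp' t' u' y' acc' o' al'P rp'P rp'0 al'E.
arith i.+1. jlt; have -> : i.+1 < r by move: rE => /=; lia.
eapply leads_mono.
- eapply IH; [ | | | exact: al'P | exact: rp'P | exact: rp'0].
  + by rewrite rE /= addSnnS.
  + by rewrite /acc'; case: ifP; rewrite ?size_rcons // => _; exact: leqW.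
  + by move=> i' i'A; rewrite al'E ?addSnnS ?al_rest //; lia.
- exact: leqnn.
move=> _ [al2 [rp2 [t2 [u2 [y2 [-> al2P rp2P]]]]]].
exists al2, rp2, t2, u2, y2; split=> //.
rewrite -catA -encode_seq_cat; congr (state _ _ _ (_ ++ encode_seq _)).
by rewrite /o' /acc' /=; case: ifP.
Qed.

End Group.

Lemma star_loop (A : seq 'I_n) fr p pe z a ae u s jj pp wd cls al mk st nw rp :
  size A <= n -> lists al A -> forall N i o t y, size A = i + N ->
  leads w P
    (state 104 (registers n B qq (size A) fr p pe i (nat_of_ord z) a ae t u s y jj pp)
       (layout B inp [:: cls; al; mk; st; nw; rp; wd]) o)
    (8 * N + 1)
    (fun c => halted P c /\
       out c = o ++ encode_seq [seq (v, z) | v <- drop i A]).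
Proof.
move=> An alA; elim=> [|N IH] i o t y AE.
  jlt; rewrite AE addn0 ltnn; apply: leads_now.
  by rewrite drop_oversize ?AE ?addn0 // cats0.
have iA : i < size A by lia.
rewrite (_ : 8 * N.+1 + 1 = 8 + (8 * N + 1)); last lia.
have vn := ltn_ord (nth x0 A i).
jlt; rewrite iA. arith (i * 8). arith (i * 8 + (B + 1)).
fetch (nat_of_ord (nth x0 A i)); first by rewrite layout_get //= alA.
output.
output.
arith i.+1. jmp.
eapply leads_mono; [eapply IH; lia | lia | move=> c [hc ->]; split=> //].
by rewrite -!cats1 -!catA (drop_nth x0 iA).
Qed.

Definition total_degree : nat := degrees_off [::].

(* The literal 2 ^ lq of the program may exceed a word; it then becomes 0, and
   dividing by 0 gives 0, which is the right quotient. *)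
Lemma div_pow_mod r : r < W -> r %/ qq = r %/ 2 ^ lq.
Proof.
move=> rW; have [lt|ge] := ltnP (2 ^ lq) W; first by rewrite modn_small.
have wlq : w <= lq by rewrite -(leq_exp2l _ _ (isT : 1 < 2)) WE.
rewrite -WE (eqP (dvdn_exp2l 2 wlq)) divn0 divn_small //.
exact: leq_trans ge.
Qed.

(** Invariant between rounds. [p + size A <= n] leaves enough stored words for all later rounds, and
    the bounds by [p] make every stamp in [mk] and [st] stale. *)
Record ready (A : seq 'I_n) (p fr : nat) (al mk st nw rp wd : nat -> nat) : Prop :=
  Ready {
    ready_A : 0 < size A;
    ready_p : p + size A <= n;
    ready_al : lists al A;
    ready_mk : forall v : 'I_n, mk v <= p;
    ready_st : forall c, st c <= p;
    ready_nw : forall c, nw c < W;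
    ready_rp : forall c, fr <= c -> rp c = 0;
    ready_wd : words wd
  }.

Hypothesis lq_gt0 : 0 < lq.
Hypothesis halves : forall A ws', 0 < size A %/ 2 ^ lq ->
  2 * size (survivors e x0 (2 ^ lq) A ws') <= size A.

Lemma round_correct (A : seq 'I_n) p fr (cls al mk st nw rp wd : nat -> nat)
    o pe i x a ae t u s y jj pp :
  ready A p fr al mk st nw rp wd ->
  0 < size A %/ 2 ^ lq -> fr + total_degree.+1 <= Z ->
  leads w P
    (state 23 (registers n B qq (size A) fr p pe i x a ae t u s y jj pp)
       (layout B inp [:: cls; al; mk; st; nw; rp; wd]) o)
    (60 * n + 20 * total_degree)
    (fun c => exists (cls' al' mk' st' nw' rp' : nat -> nat) fr'
         pe i x a ae t u s y jj pp,
       let A' := survivors e x0 (2 ^ lq) A (drop p ws) in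
       let p' := p + size A %/ 2 ^ lq in
       [/\ c = state 23
             (registers n B qq (size A') fr' p' pe i x a ae t u s y jj pp)
             (layout B inp [:: cls'; al'; mk'; st'; nw'; rp'; wd])
             (o ++ encode_seq (round_pairs e x0 (2 ^ lq) A (drop p ws))),
           ready A' p' fr' al' mk' st' nw' rp' wd & fr' <= fr + total_degree.+1]).
Proof.
case=> A0 pA alA mkP stP nwP rpP wdP k0 frZ.
set k := size A %/ 2 ^ lq in k0 *.
have n0 : 0 < n by exact: leq_trans A0 (leq_trans (leq_addl _ _) pA).
have kA : 2 * k <= size A.
  have lq0 : 1 < 2 ^ lq.
    by rewrite -(expn0 2) ltn_exp2l.
  by rewrite mulnC (leq_trans _ (leq_trunc_div (size A) (2 ^ lq))) // leq_mul2l lq0 orbT.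
have An : size A <= n by lia.
have [v [A1 AE]] : exists v A1, A = v :: A1.
  by case: (A) A0 => // v A1 _; exists v, A1.
eapply leads_mono; last by move=> c; exact.
  eapply (@leads_bind _ _ _ 4).
    arith k; first by rewrite div_pow_mod //; lia.
    jlt; rewrite k0. arith (p + k). arith 0.
    by apply: leads_now; exact: erefl.
  move=> _ <-; eapply leads_bind.
    eapply (@init_loop) with (N := n.-1) (i := 0) => //; lia.
  move=> _ [cls' [t' [-> cls'P]]].
  eapply (@leads_bind _ _ _ 1).
    arith fr.+1. by apply: leads_now; exact: erefl.
  move=> _ <-; eapply leads_bind.
    rewrite -{1}[p]addn0.
    eapply sample_loop with (lo := fr) (j := 0) (N := k.-1)
      (F := fr + total_degree.+1) => //.
    + by rewrite A0.
    + lia.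
    + lia.
    + by rewrite take0; apply: classifies_nil => z; exact: cls'P.
    + move=> z; rewrite take0 in_nil; have := mkP z; split; first lia.
      by apply/eqP; lia.
    + by move=> c; rewrite addn0.
    + by rewrite take0 addSnnS; exact: leqnn.
  move=> _ [cls2 [mk2 [st2 [nw2 [fr2 [x2 [a2 [ae2 [t2 [u2 [s2 [y2 [pp2
    [-> [cl2 cl2_lt] mk2P st2P [nw2P fr2P]]]]]]]]]]]]]]].
  eapply (@leads_bind _ _ _ 2).
    arith 0. arith 0. by apply: leads_now; exact: erefl.
  move=> _ <-; eapply leads_bind.
    eapply group_loop with (v := v) (A := A1) (acc := [::])
      (eqv := same_trace e (sample x0 A (take k (drop p ws)))) => //.
    + by apply: leq_trans frZ; case/andP: fr2P.
    + by move=> z; case/andP: (cl2_lt z).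
    + by rewrite AE.
    + by move=> i' i'A; rewrite add0n alA AE.
    + by move=> z; rewrite rpP //; case/andP: (cl2_lt z).
    + by move=> c frc; apply: rpP; apply: leq_trans frc; case/andP: fr2P => /ltnW.
  rewrite -AE; move=> _ [al3 [rp3 [t3 [u3 [y3 [-> al3P rp3P]]]]]].
  have half := halves (drop p ws) k0.
  have reps_A : size (reps (same_trace e (sample x0 A (take k (drop p ws)))) [::] A)
      <= size A.
    by apply: leq_trans half; exact: leq_pmull.
  eapply (leads_mono (b := 2)); [|exact: leqnn|by move=> c; exact].
  arith (size (reps (same_trace e (sample x0 A (take k (drop p ws)))) [::] A)).
    by rewrite addn0.
  jmp; apply: leads_now.
  exists cls2, al3, mk2, st2, nw2, rp3, fr2; do 11!eexists; split; first reflexivity.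
  - split=> //.
    + exact: reps_size_gt0.
    + rewrite -/k -(leq_pmul2l (isT : 0 < 2)) 2!mulnDr -addnA.
      apply: (@leq_trans (2 * p + (size A + size A))).
        by rewrite leq_add2l; apply: leq_add.
      by rewrite addnn -mul2n -mulnDr leq_mul2l.
  - by case/andP: fr2P.
have degE : degrees_off (sample x0 A (take 0 (drop p ws))) = total_degree by rewrite take0.
have A1E : (size A1).+1 = size A by rewrite AE.
by rewrite degE A1E; lia.
Qed.

(** Each unit of fuel reserves [total_degree.+1] class numbers: a round opens one class for all
    vertices and at most one more per scanned neighbour. *)
Lemma main_loop fuel (A : seq 'I_n) p fr (cls al mk st nw rp wd : nat -> nat)
    o pe i x a ae t u s y jj pp :
  ready A p fr al mk st nw rp wd ->
  size A < 2 ^ fuel -> fr + fuel * total_degree.+1 <= Z ->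
  leads w P
    (state 23 (registers n B qq (size A) fr p pe i x a ae t u s y jj pp)
       (layout B inp [:: cls; al; mk; st; nw; rp; wd]) o)
    (fuel * (60 * n + 20 * total_degree) + 8 * n + 6)
    (fun c => halted P c /\
       out c = o ++ encode_seq (algo e x0 (2 ^ lq) fuel A (drop p ws))).
Proof.
elim: fuel A p fr cls al mk st nw rp o pe i x a ae t u s y jj pp
    => [|fuel IH] A p fr cls al mk st nw rp o pe i x a ae t u s y jj pp rdy Afuel frZ.
  by have := ready_A rdy; move: Afuel; rewrite expn0; case: (size A).
have A0 := ready_A rdy; have pA := ready_p rdy; have alA := ready_al rdy.
have An : size A <= n by lia.
rewrite /=; case kE: (size A %/ 2 ^ lq) => [|k].
  apply: (leads_mono (b := 5 + (8 * (size A).-1 + 1))); last by move=> c; exact.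
    arith 0; first by rewrite div_pow_mod //; lia.
    jlt; rewrite ltnn; jmp. arith 1.
    have hn := ltn_ord (head x0 A).
    fetch (nat_of_ord (head x0 A)); first by rewrite -[B + 1]add0n -(mul0n 8) layout_get //= alA.
    rewrite /star -drop1; apply: star_loop => //; lia.
  by lia.
have k0 : 0 < size A %/ 2 ^ lq by rewrite kE.
rewrite -kE; eapply leads_mono; last by move=> c; exact.
  eapply leads_bind.
    by eapply round_correct => //; move: frZ; rewrite mulSn; lia.
  move=> _ [cls' [al' [mk' [st' [nw' [rp' [fr' [pe' [i' [x' [a' [ae' [t' [u' [s' [y'
    [jj' [pp' [-> rdy' fr'P]]]]]]]]]]]]]]]]]]].
  eapply leads_mono.
  - eapply IH; [exact: rdy' | | ].
    + rewrite -(ltn_pmul2l (isT : 0 < 2)) -expnS.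
      exact: leq_ltn_trans (halves _ k0) Afuel.
    + by move: frZ; rewrite mulSn; lia.
  - exact: leqnn.
  by move=> c [hc ->]; rewrite encode_seq_cat catA drop_drop addnC.
by rewrite mulSn; lia.
Qed.

Hypothesis inp_0 : inp 0 = n.
Hypothesis n_gt0 : 0 < n.

Lemma prelude_start tape : size tape = 13 ->
  foldl (step w P) (state 0 (nseq 25 0) (layout B inp (nseq 7 zero_array)) [::]) tape =
  state 13 (registers n B qq 0 0 0 0 0 0 0 0 (n + 2) 0 0 0 0 0)
    (layout B inp (nseq 7 zero_array)) [::].
Proof.
do 13!(case: tape => [//|? tape]); case: tape => [|//] _.
rewrite [nseq 25 0]/= [nseq 7 _]/=; fetch n.
const 1. const 8. const 2. arith (n + 2).
fetch (B + 0); first by rewrite layout_inp ?addn2 ?inp_off ?off_n ?addn0 //; lia.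
arith (B + 1). arith (B + 2). arith (B + 3). arith (B + 4). arith (B + 5).
arith (B + 6). const (2 ^ lq %% W). by [].
Qed.

(** The configuration reached depends on the tape here, so [leads] does not apply. An iteration
    takes 8 steps whatever the words are, which puts the words of [Rand] at known places. *)
Lemma prelude_loop N i tape (al wd : nat -> nat) t u :
  n = i + N.+1 -> size tape = 8 * N.+1 -> all (fun x => x < W) tape ->
  (forall j, j < i -> al j = j) ->
  exists (al' wd' : nat -> nat) t' u',
  [/\ foldl (step w P) (state 13 (registers n B qq 0 0 0 0 i 0 0 0 t u 0 0 0 0)
        (layout B inp [:: zero_array; al; zero_array; zero_array; zero_array;
           zero_array; wd]) [::]) tape =
      state 21 (registers n B qq 0 0 0 0 n 0 0 0 t' u' 0 0 0 0)
        (layout B inp [:: zero_array; al'; zero_array; zero_array; zero_array;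
           zero_array; wd']) [::],
      forall j, j < n -> al' j = j,
      forall j, j < i -> wd' j = wd j &
      forall j, j <= N -> wd' (i + j) = nth 0 (picks 8 4 N.+1 tape) j].
Proof.
elim: N i tape al wd t u => [|N IH] i tape al wd t u nE sz tapeW alP.
  move: sz tapeW; do 8!(case: tape => [//|? tape]); case: tape => [_|//].
  rewrite [all _ _]/= => /and5P[_ _ _ _ /andP[xW _]]; do 4!eexists; split.
  - arith (i * 8). arith (i * 8 + (B + 1)). store. arith (i * 8 + (B + 6)).
    rand. store. arith n. jlt. rewrite ltnn. reflexivity.
  - by move=> j jn /=; case: eqP => // ji; apply: alP; lia.
  - by move=> j ji /=; case: eqP => // ji'; lia.
  - by case=> // _; rewrite addn0 /= eqxx.
rewrite mulnS in sz; move: sz tapeW; do 4!(case: tape => [//|? tape]).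
case: tape => [//|rnd tape]; do 3!(case: tape => [//|? tape]).
rewrite [all _ _]/= => -[sz] /and5P[_ _ _ _ /and5P[rndW _ _ _ tapeW]].
have [||||al' [wd' [t' [u' [run_eq al'P wd'_old wd'P]]]]] := IH i.+1 tape
  [eta al with i |-> i] [eta wd with i |-> rnd] (i * 8 + (B + 6)) rnd.
- by rewrite nE addSnnS.
- by rewrite sz.
- by [].
- by move=> j ji /=; case: eqP => // ji'; apply: alP; lia.
exists al', wd', t', u'; split=> //.
- arith (i * 8). arith (i * 8 + (B + 1)). store. arith (i * 8 + (B + 6)).
  rand. store. arith i.+1. jlt. have -> : i.+1 < n by lia.
  exact: run_eq.
- move=> j ji; rewrite wd'_old /=; last by lia.
  by case: eqP => // ji'; lia.
case=> [|j] jN; first by rewrite addn0 wd'_old //= eqxx.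
by rewrite -addSnnS wd'P //= drop0.
Qed.

Lemma prelude tape : size tape = 13 + 8 * n + 2 -> all (fun x => x < W) tape ->
  exists (al wd : nat -> nat) t u,
  [/\ foldl (step w P)
        (state 0 (nseq 25 0) (layout B inp (nseq 7 zero_array)) [::]) tape =
      state 23 (registers n B qq n 1 0 0 n 0 0 0 t u 0 0 0 0)
        (layout B inp [:: zero_array; al; zero_array; zero_array; zero_array;
           zero_array; wd]) [::],
      forall j, j < n -> al j = j &
      forall j, j < n -> wd j = nth 0 (picks 8 4 n (drop 13 tape)) j].
Proof.
move=> sz tapeW; set s := drop 13 tape.
have s_size : size s = 8 * n + 2 by rewrite size_drop sz; lia.
have [||||al [wd [t [u [run_eq alP _ wdP]]]]] :=
  @prelude_loop n.-1 0 (take (8 * n) s) zero_array zero_array (n + 2) 0.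
- by lia.
- by rewrite size_takel ?s_size ?leq_addr //; congr (_ * _); lia.
- by apply/allP => x /mem_take /mem_drop /(allP tapeW).
- by [].
exists al, wd, t, u; split=> //; last first.
  move=> j jn; rewrite -[j in LHS]add0n wdP ?prednK //; last by lia.
  by rewrite picks_take.
rewrite -(cat_take_drop 13 tape) foldl_cat prelude_start; last by rewrite size_takel ?sz //; lia.
rewrite -/s -(cat_take_drop (8 * n) s) foldl_cat run_eq.
have : size (drop (8 * n) s) = 2 by rewrite size_drop s_size addKn.
case: (drop _ _) => [//|? [//|? [|//]]] _.
by arith n; arith 1.
Qed.

(** Allows a worst-case number of steps to be fixed in advance for all tapes. *)
Lemma halted_run c tape : halted P c -> foldl (step w P) c tape = c.
Proof.
move=> hc; elim: tape => //= x tape; suff -> : step w P c x = c by [].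
by move: hc; rewrite /halted /step; case: c => p r M o; case: (cur_instr _ _).
Qed.

Lemma program_correct fuel tape : ws = picks 8 4 n (drop 13 tape) ->
  n < 2 ^ fuel -> 1 + fuel * total_degree.+1 <= Z ->
  13 + 8 * n + 2 + (fuel * (60 * n + 20 * total_degree) + 8 * n + 6) <= size tape ->
  all (fun x => x < W) tape ->
  let c := foldl (step w P)
    (state 0 (nseq 25 0) (layout B inp (nseq 7 zero_array)) [::]) tape in
  halted P c /\ out c = encode_seq (algo e x0 (2 ^ lq) fuel (enum 'I_n) ws).
Proof.
move=> wsE n_fuel fuelZ sz tapeW.
set t1 := 13 + 8 * n + 2 in sz.
have t1_le : t1 <= size tape by apply: leq_trans sz; exact: leq_addr.
have [||al [wd [t [u [run1 alP wdP]]]]] := @prelude (take t1 tape).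
- exact: size_takel.
- by apply/allP => x /mem_take /(allP tapeW).
have {}wdP : words wd.
  move=> j jn; rewrite wdP // wsE /t1 -addnA addnC -take_drop picks_take //.
  exact: leq_addr.
have [||t2 t2_le [c2 [c2_halt c2_out] run2]] := @main_loop fuel (enum 'I_n) 0 1
  zero_array al zero_array zero_array zero_array zero_array wd [::] 0 n 0 0 0 t u 0 0 0 0 _ _ fuelZ.
- split; rewrite ?size_enum_ord //.
  + by move=> j; rewrite size_enum_ord => jn; rewrite nth_enum_ord ?alP.
  + by move=> c; rewrite /zero_array; lia.
- by rewrite size_enum_ord.
rewrite size_enum_ord in run2.
rewrite /= -(cat_take_drop t1 tape) foldl_cat run1.
rewrite -(cat_take_drop t2 (drop t1 tape)) foldl_cat run2; last first.
  by rewrite size_takel // size_drop; lia.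
by rewrite halted_run // c2_halt c2_out drop0.
Qed.

End Program.

(** * Addresses in the encoded graph *)

Section Encoding.
Variables (n m : nat) (adj : 'I_n -> seq 'I_n).

Definition list_address (x : nat) : nat := n + 3 + \sum_(u < n | u < x) size (adj u).

Lemma list_address_succ (x : 'I_n) : list_address x.+1 = list_address x + size (adj x).
Proof.
rewrite /list_address -[RHS]addnA; congr addn.
rewrite (bigD1 x) //= addnC; congr addn.
by apply: eq_bigl => u; rewrite ltnS ltn_neqAle andbC.
Qed.

Lemma list_address_le x y : x <= y -> list_address x <= list_address y.
Proof.
move=> xy; rewrite leq_add2l big_mkcond [leqRHS]big_mkcond /=; apply: leq_sum => u _.
by case: ltnP => // ux; rewrite (leq_trans ux xy).
Qed.

Lemma list_address_last : list_address n = n + 3 + \sum_(u < n) size (adj u).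
Proof. by congr addn; apply: eq_bigl => u; rewrite ltn_ord. Qed.

Let lists := [seq [seq val v | v <- adj u] | u <- enum 'I_n].

Let shape_lists : shape lists = [seq size (adj u) | u <- enum 'I_n].
Proof. by rewrite /shape -map_comp; apply: eq_map => u /=; rewrite size_map. Qed.

Lemma size_encode_graph : size (encode_graph m adj) = list_address n.
Proof.
rewrite /encode_graph !size_cat size_map size_iota size_flatten -/lists shape_lists.
have -> : sumn [seq size (adj u) | u <- enum 'I_n] = \sum_(u < n) size (adj u).
  by rewrite sumnE big_map big_enum.
by rewrite list_address_last /=; lia.
Qed.

Lemma nth_encode_graph_address x : x <= n ->
  nth 0 (encode_graph m adj) x.+2 = list_address x.
Proof.
move=> xn; rewrite /encode_graph; set s := (X in [:: n; m] ++ X).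
rewrite -[LHS]/(nth 0 s x) /s nth_cat size_map size_iota ltnS xn.
by rewrite (nth_map 0) ?size_iota ?ltnS // nth_iota ?ltnS.
Qed.

Lemma nth_encode_graph_adj x0 (x : 'I_n) j : j < size (adj x) ->
  nth 0 (encode_graph m adj) (list_address x + j) = nth x0 (adj x) j.
Proof.
move=> jx; rewrite /encode_graph /list_address catA nth_cat /= size_map size_iota.
set S := \sum_(_ < _ | _) _.
have -> : (n + 3 + S + j < n.+3) = false by apply: negbTE; rewrite -leqNgt; lia.
have -> : n + 3 + S + j - n.+3 = S + j by lia.
have -> : S = sumn (take x (shape lists)).
  rewrite shape_lists /S -map_take sumnE big_map.
  have -> : take x (enum 'I_n) = [seq u : 'I_n <- enum 'I_n | u < x].
    apply: (inj_map val_inj); rewrite map_take val_enum_ord.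
    rewrite (_ : [seq u : 'I_n <- enum 'I_n | u < x] = filter (preim val (fun k => k < x)) (enum 'I_n)) //.
    rewrite -filter_map val_enum_ord take_iota (minn_idPl (ltnW (ltn_ord x))).
    exact/esym/(@filter_iota_ltn 0)/ltnW.
  by rewrite big_filter big_enum_cond.
have nth_shape : nth 0 (shape lists) x = size (adj x).
  by rewrite shape_lists (nth_map x) ?size_enum_ord // nth_ord_enum.
rewrite -/lists -[sumn _ + j]/(flatten_index (shape lists) x j) nth_flatten.
rewrite flatten_indexKl ?flatten_indexKr ?nth_shape //.
rewrite (nth_map x) ?size_enum_ord // nth_ord_enum (nth_map x0) //.
Qed.

End Encoding.

Lemma sum_degree_le (n : nat) (e : rel 'I_n) (adj : 'I_n -> seq 'I_n) :
  adjacency_lists e adj -> \sum_(u < n) size (adj u) <= 2 * #|edges e|.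
Proof.
move=> adjP.
have -> : \sum_(u < n) size (adj u) = #|[set p : 'I_n * 'I_n | e p.1 p.2]|.
  rewrite -sum1dep_card -(pair_big_dep xpredT e (fun _ _ => 1)) /=.
  by apply: eq_bigr => u _; rewrite (perm_size (adjP u)) -cardE sum1_card.
rewrite -sum1_card (partition_big_imset (fun p : 'I_n * 'I_n => [set p.1; p.2])) /=.
have -> : [set [set p.1; p.2] | p in [set p : 'I_n * 'I_n | e p.1 p.2]] = edges e.
  by apply/setP => E; apply/imsetP/imsetP => -[p]; rewrite ?inE => pe ->; exists p; rewrite ?inE.
rewrite mulnC -sum_nat_const; apply: leq_sum => _ /imsetP[[a b] _ ->] /=.
(* Only the two ordered pairs [(a, b)] and [(b, a)] can give the edge with ends [a] and [b]. *)
rewrite sum1dep_card; apply: leq_trans (card_size [:: (a, b); (b, a)]).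
apply/subset_leq_card/subsetP => -[u v]; rewrite !inE /= => /andP[_ /eqP /setP h].
have := h u; have := h v; have := h a; have := h b.
rewrite !inE !eqxx !orbT !xpair_eqE /= [b == u]eq_sym [b == v]eq_sym
  [a == u]eq_sym [a == v]eq_sym.
by case: (u == a); case: (u == b); case: (v == a); case: (v == b).
Qed.

(** The value 2^(2d+4) is twice the number 2^(2d+3) of traces allowed per sampled vertex, which
    leaves at most half of the vertices, whatever the words are. *)
Lemma survivors_half (V : finType) (e : rel V) (x0 : V) d A ws :
  simple_graph e -> twin_width_le e d -> 0 < size A %/ 2 ^ (2 * d + 4) ->
  2 * size (survivors e x0 (2 ^ (2 * d + 4)) A ws) <= size A.
Proof.
move=> e_simple tw k0; set q := 2 ^ _ in k0 *.
apply: leq_trans (leq_trunc_div (size A) q).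
set X := sample x0 A (take (size A %/ q) ws).
have X_card : #|[set x in X]| <= size A %/ q.
  apply: leq_trans (_ : size X <= _); first by rewrite cardsE card_size.
  by rewrite size_map size_take_min geq_minl.
have few_traces := neighbourhood_complexity_le e_simple tw k0 X_card.
have qE : q = 2 * 2 ^ (2 * d + 3) by rewrite -expnS -addnS.
rewrite [X in _ <= _ * X]qE mulnCA leq_mul2l /=.
exact: leq_trans (reps_size_traces _ _ (proj1 e_simple)) few_traces.
Qed.

Lemma bit_length_bounds n : 1 < n ->
  [/\ n < 2 ^ bit_length n, 1 < bit_length n <= n & bit_length n <= 2 * trunc_log 2 n].
Proof.
move=> n1; have /andP[lo hi] := trunc_log_bounds (isT : 1 < 2) (ltnW n1).
have log0 : 0 < trunc_log 2 n by rewrite trunc_log_gt0 n1.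
rewrite /bit_length; split=> //; last by lia.
by rewrite ltnS log0 /= (leq_trans _ lo) // ltn_expl.
Qed.

(** The left side is the input size plus 8 cells per array index plus a margin. It is cubic in [n],
    with constants absorbed by [3 ^ 7 <= n.+1 ^ 7]; and [n.+1 ^ 10] is at most
    [2 ^ (10 * bit_length n)]. *)
Lemma word_size_bound n D : 1 < n -> D <= n * n ->
  n + 3 + D + 8 * (1 + bit_length n * D.+1 + n) + 16 <= 2 ^ (10 * bit_length n).
Proof.
move=> n1 Dn; have [hi /andP[_ Ln] _] := bit_length_bounds n1.
rewrite [10 * _]mulnC expnM; apply: (@leq_trans (n.+1 ^ 10)); last by rewrite leq_exp2r.
have LD : bit_length n * D.+1 <= n * (n * n).+1 by exact: leq_mul.
have n3 : 3 ^ 7 <= n.+1 ^ 7 by rewrite leq_exp2r.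
have -> : n.+1 ^ 10 = n.+1 ^ 7 * (n.+1 * n.+1 * n.+1).
  by rewrite -[10]/(7 + 3) expnD; congr muln; rewrite !expnS expn0 muln1 mulnA.
apply: leq_trans (leq_mul n3 (leqnn _)); rewrite (_ : 3 ^ 7 = 2187) //.
by nia.
Qed.

Definition running_time (n D : nat) : nat :=
  13 + 8 * n + 2 + (bit_length n * (60 * n + 20 * D) + 8 * n + 6).

Lemma run_prog (n m d : nat) (e : rel 'I_n) (adj : 'I_n -> seq 'I_n) (x0 : 'I_n) tape :
  1 < n -> simple_graph e -> twin_width_le e d -> adjacency_lists e adj ->
  let D := \sum_(u < n) size (adj u) in
  let w := 10 * bit_length n in
  size tape = running_time n D -> all (fun x => x < 2 ^ w) tape ->
  let c := run w (prog (2 * d + 4)) (encode_graph m adj) tape in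
  halted (prog (2 * d + 4)) c /\
  out c = encode_seq (algo e x0 (2 ^ (2 * d + 4)) (bit_length n) (enum 'I_n)
                        (picks 8 4 n (drop 13 tape))).
Proof.
move=> n1 e_simple tw adjP D w sz tapeW.
have Dn : D <= n * n.
  apply: (@leq_trans (\sum_(u < n) n)); last by rewrite sum_nat_const card_ord.
  apply: leq_sum => u _; rewrite (perm_size (adjP u)) -cardE.
  by rewrite -[leqRHS]card_ord max_card.
have [hi /andP[L1 Ln] _] := bit_length_bounds n1.
have WB := word_size_bound n1 Dn; rewrite -/w in WB.
pose inp i := nth 0 (encode_graph m adj) i %% 2 ^ w.
have DE : total_degree adj = D by apply: eq_bigl.
have lastE : list_address adj n = n + 3 + D := list_address_last adj.
rewrite /run /init_config.
have -> : Config 0 (fun=> 0) (fun i => nth 0 (encode_graph m adj) i %% 2 ^ w) [::] =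
    state 0 (nseq 25 0) (layout (list_address adj n) inp (nseq 7 zero_array)) [::].
  rewrite /state; congr Config; apply/funext => i; first by rewrite nth_nseq if_same.
  rewrite /layout; case: ltnP => // le_i.
  by rewrite nth_default ?size_encode_graph // mod0n nth_nseq if_same.
apply: (program_correct (W := 2 ^ w) (Z := 1 + bit_length n * D.+1 + n) (adj := adj)
  (off := list_address adj)) => //; rewrite ?lastE ?DE.
- by [].
- by lia.
- move=> x xn; rewrite /inp nth_encode_graph_address // modn_small //.
  by have := list_address_le adj xn; rewrite lastE; lia.
- exact: list_address_succ.
- by move=> x xn; rewrite -lastE; exact: list_address_le.
- move=> x j jx; rewrite /inp (nth_encode_graph_adj _ x0) // modn_small //.
  by apply: leq_trans (ltn_ord _) _; lia.
- exact: leq_addr.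
- exact: picks_size.
- apply: picks_all; [by [] | | by apply/allP => x /mem_drop /(allP tapeW)].
  by rewrite size_drop sz /running_time; lia.
- by rewrite addnS.
- by move=> A ws; exact: survivors_half.
- by rewrite /inp modn_small //=; lia.
- exact: ltnW.
- exact: leq_addr.
- by rewrite sz.
Qed.

(** * Success probability of the program *)

Section SuccessProbability.
Variables (R : realType) (c : R) (n m d delta : nat) (e : rel 'I_n)
  (adj : 'I_n -> seq 'I_n).
Hypothesis n_gt1 : (1 < n)%N.
Hypothesis e_simple : simple_graph e.
Hypothesis tw : twin_width_le e d.
Hypothesis adjP : adjacency_lists e adj.
Local Open Scope ring_scope.

Let q := (2 ^ (2 * d + 4))%N.

Hypothesis q_delta : (q <= delta)%N.
Hypothesis delta_ge : 4 * q%:R * ((c + 3) * ln n%:R) <= delta%:R.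

Let n_gt0 : 0 < n%:R :> R. Proof. by rewrite ltr0n ltnW. Qed.

(** At most [n] rounds and n^2 pairs give a factor n^3, while each exponential is at most n^-(c+3);
    this is the origin of [c + 3]. *)
Lemma total_failure_bound :
  (bit_length n)%:R * round_failure_bound R 'I_n q delta <= n%:R `^ (- c).
Proof.
have q_gt0 : 0 < q%:R :> R by rewrite ltr0n expn_gt0.
have [_ /andP[_ Ln] _] := bit_length_bounds n_gt1.
rewrite /round_failure_bound card_ord.
apply: (@le_trans _ _ (n%:R ^+ 3 * expR (- ((c + 3) * ln n%:R)))).
  rewrite exprS -mulrA natrX; apply: ler_pM; rewrite ?mulr_ge0 ?expR_ge0 ?exprn_ge0 //.
    by rewrite ler_nat.
  rewrite ler_wpM2l ?exprn_ge0 // ler_expR lerN2 ler_pdivlMr ?mulr_gt0 //.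
  by rewrite mulrC.
rewrite -{1}(lnK (_ : n%:R \in Num.pos)) // -expRM_natl -expRD /powR gt_eqF //.
by rewrite ler_expR mulrDl mulNr; lra.
Qed.

(** On every tape the indicators of success and of [bad] add up to at least 1; it remains to take
    expectations. *)
Lemma success_prob_prog (good : seq nat -> Prop) :
  (forall s : seq ('I_n * 'I_n), sd_degeneracy_seq s -> (sd_width e s <= delta)%N ->
     good (encode_seq s)) ->
  1 - n%:R `^ (- c) <= success_prob R (10 * bit_length n) (prog (2 * d + 4))
    (encode_graph m adj) (running_time n (\sum_(u < n) size (adj u))%N) good.
Proof.
move=> goodP; pose x0 : 'I_n := Ordinal (ltnW n_gt1).
set D := (\sum_(u < n) _)%N; set w := (10 * bit_length n)%N.
have W_gt0 : (0 < 2 ^ w)%N by rewrite expn_gt0.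
have halves A ws : (0 < size A %/ q)%N ->
  (2 * size (survivors e x0 q A ws) <= size A)%N by exact: survivors_half.
have [hi /andP[L1 Ln] _] := bit_length_bounds n_gt1.
pose bad s := fails e x0 q delta (bit_length n) (enum 'I_n) s.
have bad_prob : expect (2 ^ w) (running_time n D)
    (fun s => (bad (picks 8 4 n (drop 13 s)))%:R) <= n%:R `^ (- c) :> R.
  apply: le_trans total_failure_bound.
  rewrite (_ : running_time n D = 13 + (8 * n + (2 + (bit_length n * (60 * n + 20 * D)
    + 8 * n + 6))))%N; last by rewrite /running_time -!addnA.
  rewrite (expect_drop _ _ _ (fun s => (bad (picks 8 4 n s))%:R)) //.
  rewrite (expect_picks _ _ _ (fun s => (bad s)%:R)) //.
  apply: fails_prob => //; rewrite ?enum_uniq ?size_enum_ord //.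
    by rewrite /q addnS expnS; have := expn_gt0 2 (2 * d + 3); lia.
  apply: leq_trans (ltnW hi) _; rewrite leq_pexp2l // leq_pmull //.
rewrite success_probE lerBlDr; apply: le_trans (lerD (lexx _) bad_prob).
rewrite -expectD -{1}(expect_const (R := R) W_gt0 (running_time n D) 1).
apply: le_expect => s sz sW.
have [halt_s out_s] := run_prog m x0 n_gt1 e_simple tw adjP sz sW.
have [bad_s|ok_s] := boolP (bad _); first by rewrite lerDr ler0n.
have [z elim_z] : exists z, eliminates e delta [set x in enum 'I_n]
    (algo e x0 q (bit_length n) (enum 'I_n) (picks 8 4 n (drop 13 s))) [set z].
  apply: algo_eliminates; rewrite ?enum_uniq ?size_enum_ord //.
  - by rewrite expn_gt0.
  - by rewrite (ltnW n_gt1).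
rewrite (_ : [set x in enum 'I_n] = [set: 'I_n]) in elim_z; last first.
  by apply/setP => x; rewrite !inE mem_enum.
have [deg_s width_s] := eliminates_sd_degeneracy elim_z.
rewrite halt_s (_ : `[< _ >] = true) ?lerDl ?ler0n //; apply/asboolP.
by rewrite out_s; exact: goodP.
Qed.

End SuccessProbability.

Local Open Scope ring_scope.

Lemma bit_length_le_ln (R : realType) n : (1 < n)%N ->
  (bit_length n)%:R <= 2 / ln 2 * ln n%:R :> R.
Proof.
move=> n1; have [_ _ Llog] := bit_length_bounds n1.
have ln2 : 0 < ln 2 :> R by rewrite ln_gt0 ?ltr1n.
rewrite mulrAC ler_pdivlMr //.
have : (trunc_log 2 n)%:R * ln 2 <= ln n%:R :> R.
  rewrite mulr_natl -lnXn // ler_ln ?posrE ?exprn_gt0 ?ltr0n ?(ltnW n1) //.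
  by rewrite -natrX ler_nat trunc_logP // ltnW.
have : (bit_length n)%:R <= 2 * (trunc_log 2 n)%:R :> R by rewrite -natrM ler_nat.
by move=> h1 h2; nra.
Qed.

Lemma running_time_le n D m : (1 < n)%N -> (D <= 2 * m)%N ->
  (running_time n D <= 100 * (bit_length n * (m + n)))%N.
Proof.
move=> n1 Dm; have [_ /andP[L1 _] _] := bit_length_bounds n1.
rewrite /running_time; move: (bit_length n) L1 => L L1; nia.
Qed.

Theorem theorem4p1 (R : realType) :
  exists f : nat -> nat,
    [/\ forall d : nat, (1 <= f d)%N,
        exists C d0 : nat,
          forall d : nat, (d0 <= d)%N -> (f d <= 2 ^ (2 ^ (C * d)))%N
      & forall c : R, 0 < c ->
        exists (K : R) (k : nat),
        forall d : nat,
        exists P : program,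
        forall (n m : nat) (e : rel 'I_n) (adj : 'I_n -> seq 'I_n),
          (0 < n)%N -> simple_graph e -> #|edges e| = m ->
          twin_width_le e d -> adjacency_lists e adj ->
          exists T : nat,
            T%:R <= K * ((f d)%:R * (m + n)%:R * ln n%:R) /\
            1 - n%:R `^ (- c) <=
              success_prob R (k * bit_length n) P (encode_graph m adj) T
                (fun o : seq nat =>
                   exists s : seq ('I_n * 'I_n),
                     [/\ o = encode_seq s,
                         sd_degeneracy_seq s
                       & (sd_width e s)%:R <= K * ((f d)%:R * ln n%:R)])].
Proof.
exists (fun d => 2 ^ (2 * d + 4))%N; split.
- by move=> d; rewrite expn_gt0.
(* For positive [d], 2d + 4 <= 6d < 2^(6d). *)
- exists 6%N, 1%N => d d1; rewrite leq_pexp2l //.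
  by apply: leq_trans (ltnW (ltn_expl (6 * d) (isT : 1 < 2)%N)); lia.
(* [200 / ln 2] is the 100 of [running_time_le] times the [2 / ln 2] of [bit_length_le_ln]; it also
   covers the part of [delta] that is linear in [q]. The term [4 * (c + 3)] covers [x]. *)
move=> c c_gt0; pose K : R := 200 / ln 2 + 4 * (c + 3).
have ln2 : 0 < ln 2 :> R by rewrite ln_gt0 ?ltr1n.
exists K, 10%N => d; exists (prog (2 * d + 4)) => n m e adj n_gt0 e_simple mE tw adjP.
set q := (2 ^ (2 * d + 4))%N.
have [n_le1|n_gt1] := leqP n 1.
  (* For [n = 1] the logarithm forces [T = 0], and the required probability is 1 - 1 = 0. *)
  have nE : n%:R = 1 :> R by rewrite (_ : n = 1%N) //; lia.
  exists 0%N; rewrite [in X in _ * ln X]nE ln1 !mulr0; split=> //.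
  by rewrite nE powR1 subrr /success_prob divr_ge0.
have D_le := sum_degree_le adjP; rewrite mE in D_le.
have lnn : 0 < ln n%:R :> R by rewrite ln_gt0 ?ltr1n.
have L_le := bit_length_le_ln R n_gt1.
have [_ /andP[L1 _] _] := bit_length_bounds n_gt1.
have q1 : 1 <= q%:R :> R by rewrite ler1n expn_gt0.
have ln2n : 2 <= 2 / ln 2 * ln n%:R :> R by apply: le_trans L_le; rewrite ler_nat.
have c3 : 0 <= c + 3 by rewrite addr_ge0 // ltW.
pose x : R := 4 * q%:R * ((c + 3) * ln n%:R).
have x_ge0 : 0 <= x by rewrite /x !mulr_ge0 // ltW.
(* The summand [q] serves the final stage, where fewer than [q] vertices remain; the other exceeds
   [x], as the union bound requires. *)
pose delta := (q + (Num.truncn x).+1)%N.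
have /andP[x_lo x_hi] := truncn_itv x_ge0.
have delta_le : delta%:R <= K * (q%:R * ln n%:R) :> R.
  have q_le : 2 * q%:R <= 2 / ln 2 * ln n%:R * q%:R :> R by apply: ler_wpM2r.
  have q_le' : 2 / ln 2 * ln n%:R * q%:R <= 200 / ln 2 * ln n%:R * q%:R :> R.
    apply: ler_wpM2r => //; apply: ler_wpM2r; first exact: ltW.
    by apply: ler_wpM2r; rewrite ?ler_nat // invr_ge0 ltW.
  apply: (@le_trans _ _ (2 * q%:R + x)); last first.
    apply: (@le_trans _ _ (200 / ln 2 * ln n%:R * q%:R + x)); last first.
      by rewrite /K /x le_eqVlt; apply/orP; left; apply/eqP; ring.
    by rewrite lerD2r (le_trans q_le).
  by rewrite /delta natrD -[(Num.truncn x).+1]addn1 natrD; lra.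
exists (running_time n (\sum_(u < n) size (adj u))); split.
  have := running_time_le n_gt1 D_le; rewrite -(ler_nat R) => /le_trans; apply.
  rewrite !natrM.
  have mn0 : 0 <= (m + n)%:R :> R by [].
  apply: (@le_trans _ _ (200 / ln 2 * (1 * (m + n)%:R * ln n%:R))).
    rewrite (_ : 200 / ln 2 * _ = 100 * (2 / ln 2 * ln n%:R * (m + n)%:R)); last by ring.
    by rewrite ler_wpM2l // ler_wpM2r.
  apply: ler_pM.
  - by rewrite divr_ge0 // ltW.
  - by rewrite mul1r mulr_ge0 // ltW.
  - by rewrite /K lerDl mulr_ge0.
  - by apply: ler_wpM2r; [exact: ltW | apply: ler_wpM2r].
apply: (@success_prob_prog R c n m d delta) => //.
- exact: e_simple.
- exact: tw.
- exact: leq_addr.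
- apply: ltW; apply: lt_le_trans x_hi _; rewrite ler_nat; exact: leq_addl.
move=> s deg_s width_s; exists s; split=> //.
by apply: le_trans delta_le; rewrite ler_nat.
Qed.
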